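(* Let $P=P(d,\mathbf m)$ and let $I\subsetneq P$ be a color-squarefree monomial ideal that is color-squarefree stable across colors. Then for every integer $j\ge 1$ there is an isomorphism of $\mathbb Z^{\mathbf m}$-graded modules $$\mathrm{Tor}_j^{P}(P/I,\mathbb K)\cong\bigoplus_{u\in G(I)}\ \bigoplus_{\substack{\sigma\subseteq \mathrm{sm}(u)\\ \#\sigma=j-1}}\mathbb K(-\deg u-\deg\sigma).$$
   Context: $P(d,\mathbf m)$, $d\ge1$, $\mathbf m=(m_1,\dots,m_d)\in\mathbb N^d$, is the polynomial ring over a field $\mathbb K$ in variables $x_{i,j}$, $1\le i\le d$, $1\le j\le m_i$; $x_{i,j}$ has color $i$. It is graded by $\mathbb Z^{\mathbf m}=\mathbb Z^{m_1}\times\cdots\times\mathbb Z^{m_d}$, the degree of $x_{i,j}$ being the corresponding standard basis vector; for a set $\sigma$ of variables $\deg\sigma=\sum_{x\in\sigma}\deg x$. $G(I)$ is the set of minimal monomial generators of a monomial ideal $I$. Variables are ordered by $x_{i,j}>x_{k,\ell}$ if $i<k$, or $i=k$ and $j<\ell$. A monomial is color-squarefree if it is squarefree and divisible by at most one variable of each color. A monomial ideal $I$ is color-squarefree if all its minimal monomial generators are color-squarefree. It is color-squarefree stable across colors if it is color-squarefree and: (i) if $x_{k,\ell}\cdot u\in I$ is a color-squarefree monomial and $j<\ell$, then $x_{k,j}\cdot u\in I$; (ii) if $x_{k,\ell}$ is the smallest variable dividing a color-squarefree monomial $u\in I$, $x_{i,j}>x_{k,\ell}$ and $x_{i,j}\cdot\frac{u}{x_{k,\ell}}$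 is color-squarefree, then $x_{i,j}\cdot\frac{u}{x_{k,\ell}}\in I$. For a color-squarefree monomial $u=x_{i_1,j_1}\cdots x_{i_s,j_s}\ne1$ with $i_1<\dots<i_s$, let $\mathrm{cSupp}(u)=\{i_1,\dots,i_s\}$ and $$\mathrm{sm}(u)=\{x_{p,q}: p\in[i_s]\setminus\mathrm{cSupp}(u),\ q\in[m_p]\}\cup\{x_{i_k,q}: k\in[s],\ q\in[j_k-1]\}.$$ *)

(* Defs.v *)
From HB Require Import structures.
From mathcomp Require Import all_boot all_order all_algebra.
From mathcomp Require Import finmap.
From mathcomp.multinomials Require Export monalg.
From mathcomp.classical Require Import boolp.

Set Implicit Arguments.
Unset Strict Implicit.
Unset Printing Implicit Defensive.

Import GRing.Theory.

Local Open Scope ring_scope.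
Local Open Scope quotient_scope.

Section Modules.
Variable R : comNzRingType.

Section Quotients.
Variables (V : lmodType R) (W : V -> Prop).

(* The submodule generated by W. *)
Definition span : {pred V} := fun x =>
  `[< exists2 s : seq (R * V), (forall p, p \in s -> W p.2)
      & x = \sum_(p <- s) p.1 *: p.2 >].

Lemma span_submod_closed : submod_closed span.
Proof.
split; first by apply/asboolP; exists [::]; rewrite ?big_nil.
move=> a x y /asboolP[s sW ->] /asboolP[t tW ->]; apply/asboolP.
exists ([seq (a * p.1, p.2) | p <- s] ++ t) => [p|].
  by rewrite mem_cat => /orP[/mapP[q /sW Wq ->]|/tW].
rewrite big_cat big_map scaler_sumr; congr (_ + _).
by apply: eq_bigr => p _; rewrite scalerA.
Qed.

HB.instance Definition _ :=
  GRing.isSubmodClosed.Build R V span span_submod_closed.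

Lemma mem_span x : W x -> x \in span.
Proof.
move=> Wx; apply/asboolP; exists [:: (1, x)]; last by rewrite big_seq1 scale1r.
by move=> p; rewrite inE => /eqP->.
Qed.

Lemma span_min (S : submodClosed V) :
  (forall x, W x -> x \in S) -> {subset span <= S}.
Proof.
move=> WS x /asboolP[s sW ->]; rewrite big_seq.
by apply: rpred_sum => p /sW /WS; apply: rpredZ.
Qed.

(* The quotient of V by the submodule generated by W. *)
Definition quotmod : Type := Quotient.quot span.

HB.instance Definition _ := GRing.Zmodule.on quotmod.
HB.instance Definition _ := EqQuotient.on quotmod.

Definition quot_proj (x : V) : quotmod := \pi_quotmod x.

Lemma quot_projP x y : quot_proj x = quot_proj y <-> x - y \in span.
Proof. by rewrite Quotient.idealrBE /quot_proj; split=> [/eqP|/eqP]. Qed.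

Lemma quot_proj_repr (q : quotmod) : quot_proj (repr q) = q.
Proof. exact: reprK. Qed.

Lemma quot_projD : {morph quot_proj : x y / x + y}.
Proof. by move=> x y; rewrite /quot_proj !piE. Qed.

Definition quotmod_scale (a : R) (q : quotmod) : quotmod :=
  quot_proj (a *: repr q).

Lemma quot_projZ a x : quot_proj (a *: x) = quotmod_scale a (quot_proj x).
Proof.
apply/quot_projP; rewrite -scalerBr; apply: rpredZ; apply/quot_projP.
by rewrite quot_proj_repr.
Qed.

Lemma quotmod_scaleA a b q :
  quotmod_scale a (quotmod_scale b q) = quotmod_scale (a * b) q.
Proof. by rewrite -(quot_proj_repr q) -!quot_projZ scalerA. Qed.

Lemma quotmod_scale1 : left_id 1 quotmod_scale.
Proof. by move=> q; rewrite -(quot_proj_repr q) -!quot_projZ scale1r. Qed.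

Lemma quotmod_scaleDr : right_distributive quotmod_scale +%R.
Proof.
move=> a q r; rewrite -(quot_proj_repr q) -(quot_proj_repr r).
by rewrite -!quot_projZ -!quot_projD -quot_projZ scalerDr.
Qed.

Lemma quotmod_scaleDl q : {morph quotmod_scale^~ q : a b / a + b}.
Proof.
by move=> a b; rewrite -(quot_proj_repr q) -!quot_projZ -quot_projD scalerDl.
Qed.

HB.instance Definition _ := GRing.Zmodule_isLmodule.Build R quotmod
  quotmod_scaleA quotmod_scale1 quotmod_scaleDr quotmod_scaleDl.

Lemma quot_proj_linear : linear quot_proj.
Proof. by move=> a x y; rewrite quot_projD quot_projZ. Qed.

HB.instance Definition _ :=
  GRing.isLinear.Build R V quotmod *:%R quot_proj quot_proj_linear.

Lemma quot_proj0 x : quot_proj x = 0 <-> x \in span.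
Proof. by rewrite -(linear0 quot_proj) quot_projP subr0. Qed.

End Quotients.

Section Kernel.
Variables (U V : lmodType R) (f : {linear U -> V}).

Definition in_ker : {pred U} := fun x => f x == 0.

Lemma in_ker_submod_closed : submod_closed in_ker.
Proof.
split=> [|a x y /eqP fx /eqP fy]; first by rewrite unfold_in linear0.
by rewrite unfold_in linearP fx fy scaler0 addr0.
Qed.

HB.instance Definition _ :=
  GRing.isSubmodClosed.Build R U in_ker in_ker_submod_closed.

Record ker : predArgType := Ker { ker_val : U; _ : ker_val \in in_ker }.

HB.instance Definition _ := [isSub for ker_val].
HB.instance Definition _ := [Choice of ker by <:].
HB.instance Definition _ := [SubChoice_isSubZmodule of ker by <:].
HB.instance Definition _ := [SubZmodule_isSubLmodule of ker by <:].

Lemma ker_valP (x : ker) : f (val x) = 0.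
Proof. exact/eqP/(valP x). Qed.

End Kernel.

(* {malg R[S]} is the free R-module on S; free_ext h is the linear map that
   extends h. *)
Section FreeExtension.
Variables (S : choiceType) (V : lmodType R) (h : S -> V).

Definition free_ext (g : {malg R[S]}) : V := \sum_(k <- msupp g) g@_k *: h k.

Lemma free_extEw (D : {fset S}) g : (msupp g `<=` D)%fset ->
  free_ext g = \sum_(k <- D) g@_k *: h k.
Proof.
move=> sgD; rewrite /free_ext (big_fset_incl _ sgD) //= => k _ kg.
by rewrite (mcoeff_outdom kg) scale0r.
Qed.

Lemma free_ext_linear : linear free_ext.
Proof.
move=> a x y; pose D := (msupp (a *: x + y) `|` (msupp x `|` msupp y))%fset.
have sD z : z \in [:: a *: x + y; x; y] -> (msupp z `<=` D)%fset.
  rewrite !inE => /or3P[]/eqP->; first exact: fsubsetUl.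
    by apply: fsubset_trans (fsubsetUr _ _); exact: fsubsetUl.
  by apply: fsubset_trans (fsubsetUr _ _); exact: fsubsetUr.
rewrite !(@free_extEw D) ?sD ?inE ?eqxx ?orbT // scaler_sumr -big_split /=.
by apply: eq_bigr => k _; rewrite mcoeffD mcoeffZ scalerDl scalerA.
Qed.

HB.instance Definition _ :=
  GRing.isLinear.Build R {malg R[S]} V *:%R free_ext free_ext_linear.

Lemma free_extU k : free_ext << k >> = h k.
Proof.
rewrite (@free_extEw [fset k]%fset) ?msuppU_le // big_seq_fset1.
by rewrite mcoeffUU scale1r.
Qed.

End FreeExtension.

Section Tensor.

Definition tensor_rel (M N : lmodType R) (z : {malg R[(M * N)%type]}) : Prop :=
  [\/ exists x x' y, z = << (x + x', y) >> - << (x, y) >> - << (x', y) >>,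
      exists x y y', z = << (x, y + y') >> - << (x, y) >> - << (x, y') >>,
      exists a x y, z = << (a *: x, y) >> - a *: << (x, y) >>
    | exists a x y, z = << (x, a *: y) >> - a *: << (x, y) >>].

Definition tensor (M N : lmodType R) : lmodType R := quotmod (@tensor_rel M N).

Definition tens (M N : lmodType R) (x : M) (y : N) : tensor M N :=
  quot_proj (@tensor_rel M N) << (x, y) >>.

Section TensTheory.
Variables M N : lmodType R.

Lemma tens_rel0 z : tensor_rel z -> quot_proj (@tensor_rel M N) z = 0.
Proof. by move=> Rz; apply/quot_proj0/mem_span. Qed.

Lemma tensDl (x x' : M) (y : N) : tens (x + x') y = tens x y + tens x' y.
Proof.
apply/eqP; rewrite -subr_eq0 opprD addrA -!linearB /=; apply/eqP/tens_rel0.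
by apply: Or41; exists x, x', y.
Qed.

Lemma tensDr (x : M) (y y' : N) : tens x (y + y') = tens x y + tens x y'.
Proof.
apply/eqP; rewrite -subr_eq0 opprD addrA -!linearB /=; apply/eqP/tens_rel0.
by apply: Or42; exists x, y, y'.
Qed.

Lemma tensZl a (x : M) (y : N) : tens (a *: x) y = a *: tens x y.
Proof.
apply/eqP; rewrite -subr_eq0 -linearZ -linearB /=; apply/eqP/tens_rel0.
by apply: Or43; exists a, x, y.
Qed.

Lemma tensZr a (x : M) (y : N) : tens x (a *: y) = a *: tens x y.
Proof.
apply/eqP; rewrite -subr_eq0 -linearZ -linearB /=; apply/eqP/tens_rel0.
by apply: Or44; exists a, x, y.
Qed.

End TensTheory.

(* The map f (x) id_N. *)
Section TensorMap.
Variables (M M' N : lmodType R) (f : {linear M -> M'}).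

Let tmap_free : {malg R[(M * N)%type]} -> tensor M' N :=
  free_ext (fun p => tens (f p.1) p.2).

Definition tensor_map (t : tensor M N) : tensor M' N := tmap_free (repr t).

Lemma tensor_map_proj z : tensor_map (quot_proj _ z) = tmap_free z.
Proof.
apply/eqP; rewrite -subr_eq0 -linearB; apply/eqP.
have: repr (quot_proj (@tensor_rel M N) z) - z \in span (@tensor_rel M N).
  by apply/quot_projP; rewrite quot_proj_repr.
move/(@span_min _ _ (in_ker tmap_free)) => kz; apply/eqP/kz => {kz} w.
case=> -[a [x [y ->]]]; rewrite unfold_in !linearB ?linearZ /= !free_extU /=.
- by rewrite linearD tensDl addrAC addrK subrr.
- by rewrite tensDr addrAC addrK subrr.
- by rewrite linearZ tensZl scalerN subrr.
- by rewrite tensZr scalerN subrr.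
Qed.

Lemma tensor_map_tens x y : tensor_map (tens x y) = tens (f x) y.
Proof. by rewrite tensor_map_proj /tmap_free free_extU. Qed.

Lemma tensor_map_linear : linear tensor_map.
Proof.
move=> a t u; rewrite -(quot_proj_repr t) -(quot_proj_repr u) -linearP /=.
rewrite !tensor_map_proj; exact: (linearP tmap_free).
Qed.

HB.instance Definition _ := GRing.isLinear.Build R (tensor M N) (tensor M' N)
  *:%R tensor_map tensor_map_linear.

End TensorMap.
End Tensor.
End Modules.

Section Graded.
Variables (K : fieldType) (T : finType).

Definition polyring : comNzRingType := {malg K[{cmonom T}]}.

Definition mono (u : {cmonom T}) : polyring := << u >>.

Definition multideg : zmodType := {ffun T -> int}.

Definition deg (u : {cmonom T}) : multideg := [ffun x => (u x)%:Z].

Definition deg_set (s : {set T}) : multideg := \sum_(x in s) deg (ucm x).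

(* A module with, for each degree, a set of homogeneous elements; the axioms of
   a grading are is_graded below.  A module isomorphic (in the sense of
   graded_iso) to a graded one is graded. *)
Record grmod := GrMod {
  gr_mod :> lmodType polyring;
  homog : multideg -> gr_mod -> Prop
}.

Definition graded_iso (M N : grmod) : Prop :=
  exists f : {linear M -> N},
    bijective f /\ forall a x, homog a x <-> homog a (f x).

Definition gr_poly : grmod := GrMod (gr_mod := polyring^o)
  (fun a f => forall u, u \in msupp (f : polyring) -> deg u = a).

Record is_graded (M : grmod) : Prop := IsGraded {
  homog0 : forall a, homog (g := M) a 0;
  homogB : forall a (x y : M), homog a x -> homog a y -> homog a (x - y);
  homogZ : forall a b (p : gr_poly) (x : M),
    homog b p -> homog a x -> homog (b + a) ((p : polyring) *: x);
  homog_decomp : forall x : M, exists s : seq multideg, exists f : multideg -> M,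
    [/\ uniq s, forall a, homog a (f a) & x = \sum_(a <- s) f a];
  homog_indep : forall (s : seq multideg) (f : multideg -> M), uniq s ->
    (forall a, homog a (f a)) -> \sum_(a <- s) f a = 0 ->
    forall a, a \in s -> f a = 0
}.

Definition gr_quot (M : grmod) (W : M -> Prop) : grmod :=
  GrMod (gr_mod := quotmod W)
    (fun a q => exists2 x, homog a x & quot_proj W x = q).

Definition gr_ker (M N : grmod) (f : {linear M -> N}) : grmod :=
  GrMod (gr_mod := ker f) (fun a x => homog a (val x)).

Definition gr_coker (M N : grmod) (f : {linear M -> N}) : grmod :=
  gr_quot (fun y => exists x, f x = y).

(* ker g / im f *)
Definition gr_homology (M N Q : grmod) (f : {linear M -> N})
    (g : {linear N -> Q}) : grmod :=
  gr_quot (M := gr_ker g) (fun z => exists x, f x = val z).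

(* The graded free module with basis S, the basis element s having degree
   dg s. *)
Definition gr_free (S : choiceType) (dg : S -> multideg) : grmod :=
  GrMod (gr_mod := {malg polyring[S]})
    (fun a g => forall s, homog (g := gr_poly) (a - dg s) g@_s).

Definition gr_tensor (M N : grmod) : grmod :=
  GrMod (gr_mod := tensor M N)
    (fun a t => exists2 s : seq (M * N),
       (forall p, p \in s -> exists2 b, homog b p.1 & homog (a - b) p.2)
       & t = \sum_(p <- s) tens p.1 p.2).

Definition gr_tensor_map (M M' N : grmod) (f : {linear M -> M'}) :
    {linear gr_tensor M N -> gr_tensor M' N} := tensor_map (N := N) f.

(* The direct sum of the shifted modules M(- b i), where M(- b)_a = M_(a - b). *)
Definition gr_sum_shift (Ix : finType) (b : Ix -> multideg) (M : grmod) :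
    grmod :=
  GrMod (gr_mod := {ffun Ix -> M}) (fun a f => forall i, homog (a - b i) (f i)).

(* The standard graded free resolution of M: each term is the free module on
   all homogeneous elements of the previous syzygy module.  For exactness when
   M is graded, see cover_map_surj, res_exact0 and res_exact. *)
Definition helt (M : grmod) : choiceType :=
  {p : multideg * M | `[< homog p.1 p.2 >]}.

Definition cover (M : grmod) : grmod :=
  gr_free (fun p : helt M => (val p).1).

Definition cover_map (M : grmod) : {linear cover M -> M} :=
  free_ext (fun p : helt M => (val p).2).

Definition syz (M : grmod) : grmod := gr_ker (cover_map M).

Definition res (M : grmod) (n : nat) : grmod := cover (iter n syz M).

Definition res_d (M : grmod) (n : nat) : {linear res M n.+1 -> res M n} :=
  val \o cover_map (syz (iter n syz M)).

Definition Tor (j : nat) (M N : grmod) : grmod :=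
  match j with
  | 0 => gr_coker (gr_tensor_map N (res_d M 0))
  | n.+1 => gr_homology (gr_tensor_map N (res_d M n.+1))
                        (gr_tensor_map N (res_d M n))
  end.

Definition residue_field : grmod :=
  gr_quot (M := gr_poly) (fun f => exists x : T, f = mono (ucm x)).

Definition monomial_ideal (I : polyring -> Prop) : Prop :=
  exists S : {cmonom T} -> Prop, forall f : polyring, I f <->
    f \in span (V := polyring^o) (fun g => exists2 u, S u & g = mono u).

(* u \in G(I) *)
Definition min_gen (I : polyring -> Prop) (u : {cmonom T}) : Prop :=
  I (mono u) /\
  forall v w : {cmonom T}, I (mono v) -> u = mmul v w -> v = u.

Lemma graded_coef (M : grmod) (Ix : Type) (c : Ix -> {additive M -> K})
    (e : Ix -> multideg) :
  (forall a (x : M), homog a x <-> forall i, c i x != 0 -> e i = a) ->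
  (forall x : M, (forall i, c i x = 0) -> x = 0) ->
  (forall a (x : M), exists y : M, forall i, c i y = if e i == a then c i x else 0) ->
  (forall x : M, exists s : seq multideg, forall i, c i x != 0 -> e i \in s) ->
  (forall a b (p : gr_poly) (x : M),
    homog b p -> homog a x -> homog (b + a) ((p : polyring) *: x)) ->
  is_graded M.
Proof.
move=> hE c0 cc cs hZ; split=> //.
- by move=> a; apply/hE => i; rewrite raddf0 eqxx.
- move=> a x y /hE hx /hE hy; apply/hE => i; rewrite raddfB.
  have [cx|/hx //] := eqVneq (c i x) 0; have [cy|/hy //] := eqVneq (c i y) 0.
  by rewrite cx cy subr0 eqxx.
- move=> x; have [s sx] := cs x; have /choice[f fP] := fun a => cc a x.
  exists (undup s), f; split; first exact: undup_uniq.
    by move=> a; apply/hE => i; rewrite fP; case: (e i =P a) => // _; rewrite eqxx.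
  apply/eqP; rewrite -subr_eq0; apply/eqP/c0 => i.
  rewrite raddfB raddf_sum /= (eq_bigr _ (fun a _ => fP a i)) //=.
  have [ce|/sx es] := eqVneq (c i x) 0.
    by rewrite ce big1 ?subr0 // => a _; case: eqP.
  rewrite (bigD1_seq (e i)) ?undup_uniq ?mem_undup //= eqxx big1 ?addr0 ?subrr //.
  by move=> a /negPf; rewrite eq_sym => ->.
- move=> s f us hf f0 a sa; apply: c0 => i.
  have /(congr1 (c i)) := f0; rewrite raddf0 raddf_sum /= (bigD1_seq a) //=.
  have [//|ca] := eqVneq (c i (f a)) 0; have ea := (hE _ _).1 (hf a) _ ca.
  rewrite big1 ?addr0 // => b; apply: contraNeq => cb.
  by rewrite -ea; apply/eqP/esym; exact: (hE _ _).1 (hf b) _ cb.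
Qed.

Lemma degM u v : deg (mmul u v) = deg u + deg v.
Proof. by apply/ffunP => x; rewrite !ffunE cmM PoszD. Qed.

Lemma homog_polyM a b (p q : polyring) :
  homog (g := gr_poly) a p -> homog (g := gr_poly) b q ->
  homog (g := gr_poly) (a + b) (p * q).
Proof.
move=> hp hq _ /msuppM_le[u [v [/hp <- /hq <- ->]]]; exact: degM.
Qed.

Definition homog_part (a : multideg) (p : polyring) : polyring :=
  [malg u in msupp p => if deg u == a then p@_u else 0].

Lemma homog_partE a p u : (homog_part a p)@_u = if deg u == a then p@_u else 0.
Proof. by rewrite mcoeffE; case: msuppP; rewrite // if_same. Qed.

Lemma gr_poly_graded : is_graded gr_poly.
Proof.
pose c (u : {cmonom T}) : {additive gr_poly -> K} :=
  (mcoeff u : {additive {malg K[{cmonom T}]} -> K}).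
apply: (@graded_coef gr_poly _ c deg).
- move=> a x; split=> hx u; first by rewrite mcoeff_neq0 => /hx.
  by rewrite -mcoeff_neq0 => /hx.
- by move=> x x0; apply/malgP => u; rewrite mcoeff0; exact: x0.
- by move=> a x; exists (homog_part a x) => u; exact: homog_partE.
- move=> x; exists [seq deg u | u <- msupp (x : polyring)] => u.
  by rewrite mcoeff_neq0 => xu; apply/mapP; exists u.
- by move=> a b p x; exact: homog_polyM.
Qed.

Lemma gr_free_graded (S : choiceType) (dg : S -> multideg) :
  is_graded (gr_free dg).
Proof.
pose c (i : S * {cmonom T}) : {additive gr_free dg -> K} :=
  (mcoeff i.2 : {additive {malg K[{cmonom T}]} -> K}) \o
  (mcoeff i.1 : {additive {malg polyring[S]} -> polyring}).
apply: (@graded_coef _ _ c (fun i => deg i.2 + dg i.1)).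
- move=> a x; split=> [hx [s u]|hx s u] /=.
    by rewrite mcoeff_neq0 => /hx->; rewrite subrK.
  by rewrite -mcoeff_neq0 => /(hx (s, u))/= <-; rewrite addrK.
- move=> x x0; apply/malgP => s; apply/malgP => u; rewrite !mcoeff0.
  exact: (x0 (s, u)).
- move=> a x; exists [malg s in msupp (x : {malg polyring[S]}) =>
    homog_part (a - dg s) (x : {malg polyring[S]})@_s] => -[s u] /=.
  rewrite mcoeffE -(inj_eq (addIr (- dg s))) addrK.
  case: ifPn => [_|xs]; last first.
    rewrite (mcoeff_outdom xs) [LHS]mcoeff0; case: ifP => // _.
    by rewrite [RHS]mcoeff0.
  by rewrite homog_partE.
- move=> x; exists (flatten [seq [seq deg u + dg s
    | u <- msupp ((x : {malg polyring[S]})@_s)]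
    | s <- msupp (x : {malg polyring[S]})]) => -[s u] /= xsu.
  apply/flatten_mapP; exists s; last first.
    by apply/mapP; exists u => //; rewrite -mcoeff_neq0.
  by rewrite -mcoeff_neq0; apply: contraNneq xsu => ->; rewrite mcoeff0.
- move=> a b p x hp hx s; rewrite mcoeffZ -addrA.
  exact: homog_polyM.
Qed.

Lemma gr_ker_graded (M N : grmod) (f : {linear M -> N}) :
  is_graded M -> is_graded N ->
  (forall a x, homog a x -> homog a (f x)) -> is_graded (gr_ker f).
Proof.
move=> gM gN fh; split.
- by move=> a; exact: (homog0 gM).
- by move=> a x y hx hy; exact: (homogB gM hx hy).
- by move=> a b p x hp hx; exact: (homogZ gM hp hx).
- move=> x; have [s [g [us gh xE]]] := homog_decomp gM (val x).
  have fg0 a : a \in s -> f (g a) = 0.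
    apply: (homog_indep gN (s := s) (f := f \o g)) => //= [b|]; first exact/fh.
    by rewrite -linear_sum -xE ker_valP.
  pose h a : M := if a \in s then g a else 0.
  have hP a : h a \in in_ker f.
    by rewrite unfold_in /h; case: ifP => [/fg0->|_]; rewrite ?linear0.
  exists s, (fun a => Ker (hP a)); split=> //.
    by move=> a /=; rewrite /h; case: ifP => // _; exact: (homog0 gM).
  apply/val_inj; rewrite [LHS]xE raddf_sum /=.
  by apply: eq_big_seq => a sa /=; rewrite /h sa.
- move=> s g us hg g0 a sa; apply/val_inj.
  apply: (homog_indep gM (s := s) (f := val \o g)) => //.
  by have /(congr1 val) := g0; rewrite raddf_sum.
Qed.

Lemma cover_map_homog (M : grmod) : is_graded M ->
  forall a x, homog a x -> homog a (cover_map M x).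
Proof.
move=> gM a x hx; have hD (y z : M) : homog a y -> homog a z -> homog a (y + z).
  move=> hy hz; rewrite -[z]opprK; apply: (homogB gM hy).
  by rewrite -sub0r; exact: (homogB gM (homog0 gM a) hz).
rewrite /= /free_ext; elim/big_ind: _ => //; first exact: (homog0 gM).
move=> s _; rewrite -[a](subrK (val s).1); apply: (homogZ gM); first exact: hx.
exact/asboolP/(valP s).
Qed.

Lemma cover_map_surj (M : grmod) : is_graded M ->
  forall x, exists y, cover_map M y = x.
Proof.
move=> gM x; have [s [g [_ gh ->]]] := homog_decomp gM x.
elim: s => [|a s [y IHs]]; first by exists 0; rewrite linear0 big_nil.
have ga : `[< homog (a, g a).1 (a, g a).2 >] by apply/asboolP/gh.
exists (<< (Sub (a, g a) ga : helt M) >> + y).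
by rewrite linearD IHs big_cons /= free_extU.
Qed.

Lemma syz_graded (M : grmod) n : is_graded M -> is_graded (iter n syz M).
Proof.
move=> gM; elim: n => //= n IHn; apply: gr_ker_graded => //.
  exact: gr_free_graded.
exact: cover_map_homog.
Qed.

Lemma res_exact0 (M : grmod) : is_graded M ->
  forall x, cover_map M x = 0 <-> exists y, res_d M 0 y = x.
Proof.
move=> gM x; split=> [x0|[y <-]]; last exact: ker_valP.
have kx : x \in in_ker (cover_map M) by apply/eqP.
have [y yE] := cover_map_surj (syz_graded 1 gM) (Ker kx).
by exists y; rewrite /= yE.
Qed.

Lemma res_exact (M : grmod) n : is_graded M ->
  forall x, res_d M n x = 0 <-> exists y, res_d M n.+1 y = x.
Proof.
move=> gM x.
rewrite -(res_exact0 (syz_graded n.+1 gM)); split=> [x0|x0].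
  exact/val_inj.
exact: (congr1 val x0).
Qed.

Lemma gr_quot_graded (M : grmod) (W : M -> Prop) : is_graded M ->
  (forall (s : seq multideg) (f : multideg -> M), uniq s ->
    (forall a, homog a (f a)) -> \sum_(a <- s) f a \in span W ->
    forall a, a \in s -> f a \in span W) ->
  is_graded (gr_quot W).
Proof.
move=> gM hW; split.
- by move=> a; exists 0; [exact: (homog0 gM) | rewrite linear0].
- move=> a _ _ [x hx <-] [y hy <-]; exists (x - y); last by rewrite linearB.
  exact: (homogB gM hx hy).
- move=> a b p _ hp [x hx <-]; exists ((p : polyring) *: x).
    exact: (homogZ gM hp hx).
  by rewrite linearZ.
- move=> q; have [s [f [us fh xE]]] := homog_decomp gM (repr q).
  exists s, (quot_proj W \o f); split=> // [a|]; first by exists (f a).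
  by rewrite -[LHS](quot_proj_repr q) xE linear_sum.
- move=> s f us fh f0 a sa; have /choice[g gP] : forall b, exists x : M,
      homog b x /\ quot_proj W x = f b.
    by move=> b; have [x hx xE] := fh b; exists x.
  have [gh gE] := all_and2 gP; rewrite -gE; apply/quot_proj0.
  apply: (hW s g us gh) sa; apply/quot_proj0; rewrite linear_sum -[RHS]f0.
  by apply: eq_bigr => b _; exact: gE.
Qed.

Lemma homog_part_additive a : additive (homog_part a).
Proof.
move=> p q; apply/malgP => u; rewrite mcoeffB !homog_partE mcoeffB.
by case: ifP => // _; rewrite subr0.
Qed.

HB.instance Definition _ a :=
  GRing.isAdditive.Build polyring polyring (homog_part a)
    (homog_part_additive a).

Lemma homog_part_homog a b (p : polyring) : homog (g := gr_poly) b p ->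
  homog_part a p = if b == a then p else 0.
Proof.
move=> hp; apply/malgP => u; rewrite homog_partE.
have [pu|pu] := boolP (u \in msupp p).
  by rewrite (hp u pu); case: ifP => // _; rewrite [RHS]mcoeff0.
rewrite (mcoeff_outdom pu) if_same; case: ifP => _.
  by rewrite (mcoeff_outdom pu).
by rewrite [RHS]mcoeff0.
Qed.

Lemma homog_part_sum (s : seq multideg) (f : multideg -> polyring) : uniq s ->
  (forall a, homog (g := gr_poly) a (f a)) -> forall a, a \in s ->
  homog_part a (\sum_(b <- s) f b) = f a.
Proof.
move=> us fh a sa; apply/malgP => u; rewrite homog_partE raddf_sum /=.
case: (deg u =P a) => [ua|na]; last first.
  by apply/esym/mcoeff_outdom; apply/negP => /fh.
rewrite (bigD1_seq a) //= big1 ?addr0 // => b ba.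
by apply: mcoeff_outdom; apply: contraNN ba => /fh <-; rewrite ua.
Qed.

Lemma gr_quot_monomial_graded (I : polyring -> Prop) : monomial_ideal I ->
  is_graded (gr_quot (M := gr_poly) I).
Proof.
move=> [S IE]; apply: gr_quot_graded gr_poly_graded _ => s f us fh fI a sa.
rewrite -(homog_part_sum us fh sa).
move: (\sum_(b <- s) f b) fI => {s f us fh sa} g fI.
have IS : {subset span (V := polyring^o) I
           <= span (V := polyring^o) (fun g => exists2 u, S u & g = mono u)}.
  by apply: span_min => x /IE.
move: fI => /IS/asboolP[s sS ->]; rewrite raddf_sum /= big_seq.
apply: rpred_sum => -[p q] /sS[u Su /= ->].
rewrite [p]monalgE scaler_suml raddf_sum.
apply: rpred_sum => v _; set c : polyring := << p@_v *g v >>.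
have hx : homog (g := gr_poly) (deg v + deg u) (c * mono u).
  apply: homog_polyM => w; first by move/(fsubsetP msuppU_le); rewrite inE => /eqP->.
  by move/(fsubsetP msuppU_le); rewrite inE => /eqP->.
suff: homog_part a (c * mono u) \in span (V := polyring^o) I by [].
rewrite (homog_part_homog a hx); case: ifP => _; last exact: rpred0.
apply: (rpredZ c); apply: mem_span; apply/IE/mem_span; by exists u.
Qed.

End Graded.

Section Colors.
Variables (K : fieldType) (d : nat) (m : 'I_d -> nat).

(* The variable x_(i, j) is Tagged _ j with tag i; indices start at 0. *)
Definition var : finType := {i : 'I_d & 'I_(m i)}.

Definition color (x : var) : 'I_d := tag x.

Definition var_gt (x y : var) : bool :=
  (color x < color y)%N ||
  (color x == color y) && ((tagged x : nat) < (tagged y : nat))%N.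

Definition color_squarefree (u : {cmonom var}) : Prop :=
  (forall x, u x <= 1)%N /\
  (forall x y, 0 < u x -> 0 < u y -> color x = color y -> x = y)%N.

Definition smallest_var (u : {cmonom var}) (x : var) : Prop :=
  (0 < u x)%N /\ forall y, (0 < u y)%N -> y <> x -> var_gt y x.

Definition color_squarefree_ideal (I : polyring K var -> Prop) : Prop :=
  monomial_ideal I /\ forall u, min_gen I u -> color_squarefree u.

Definition stable_across_colors (I : polyring K var -> Prop) : Prop :=
  [/\ color_squarefree_ideal I,
      forall (k : 'I_d) (j l : 'I_(m k)) (u : {cmonom var}),
        let xj : var := Tagged (fun i => 'I_(m i)) j in
        let xl : var := Tagged (fun i => 'I_(m i)) l in
        I (mono K (mmul (ucm xl) u)) -> color_squarefree (mmul (ucm xl) u) ->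
        (j < l)%N -> I (mono K (mmul (ucm xj) u))
    & forall (u : {cmonom var}) (x y : var),
        color_squarefree u -> I (mono K u) -> smallest_var u x -> var_gt y x ->
        color_squarefree (mmul (ucm y) (divcm u (ucm x))) ->
        I (mono K (mmul (ucm y) (divcm u (ucm x))))].

Definition cSupp (u : {cmonom var}) : {set 'I_d} :=
  [set i | [exists x, (0 < u x)%N && (color x == i)]].

(* The condition p <= i_s = max (cSupp u) is expressed as p <= i for some i in
   cSupp u. *)
Definition sm (u : {cmonom var}) : {set var} :=
  [set x | (color x \notin cSupp u) && [exists i in cSupp u, color x <= i]%N]
  :|: [set x | [exists y, [&& 0 < u y, color y == color x &
                             (tagged x : nat) < (tagged y : nat)]]%N].

(* Color-squarefree monomials are encoded by their sets of variables. *)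
Definition mono_set (A : {set var}) : {cmonom var} :=
  \big[mmul/mone]_(x in A) ucm x.

Lemma mono_setE A x : mono_set A x = (x \in A) :> nat.
Proof.
have [xA|xA] := boolP (x \in A); rewrite /mono_set.
  rewrite (bigD1 x) //= cmM cmUU; apply/eqP; rewrite eqSS.
  elim/big_ind: _ => [|u v /eqP u0 /eqP v0|y /andP[_ yx]].
  - by rewrite cm1.
  - by rewrite cmM u0 v0.
  - by rewrite cmU (negPf yx).
apply/eqP; elim/big_ind: _ => [|u v /eqP u0 /eqP v0|y yA].
- by rewrite cm1.
- by rewrite cmM u0 v0.
- by rewrite cmU; case: (y =P x) => // yx; rewrite -yx yA in xA.
Qed.

Lemma mono_set_inj : injective mono_set.
Proof.
move=> A B AB; apply/setP => x; apply: (can_inj oddb).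
by rewrite -!mono_setE AB.
Qed.

Lemma mono_set_supp u : color_squarefree u -> mono_set [set x | 0 < u x]%N = u.
Proof.
move=> [u1 _]; apply/eqP/cmP => x; rewrite mono_setE inE.
by case: (u x) (u1 x) => [|[]].
Qed.

(* The index set of the direct sum: the pairs (u, sigma) with u \in G(I),
   sigma \subset sm u and #|sigma| = j - 1. *)
Definition betti_pred (I : polyring K var -> Prop) (j : nat) :
    pred ({set var} * {set var}) :=
  fun p => [&& `[< min_gen I (mono_set p.1) >],
               p.2 \subset sm (mono_set p.1) & #|p.2| == j.-1].

Definition betti_index (I : polyring K var -> Prop) (j : nat) : finType :=
  {p : {set var} * {set var} | betti_pred I j p}.

Definition betti_sum (I : polyring K var -> Prop) (j : nat) : grmod K var :=
  gr_sum_shift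
    (fun p : betti_index I j => deg (mono_set (val p).1) + deg_set (val p).2)
    (residue_field K var).

End Colors.

(* Main.v *)
From HB Require Import structures.
From mathcomp Require Import all_boot all_order all_algebra.
From mathcomp Require Import finmap zify.
From mathcomp.classical Require Import boolp.
Require Import Defs.

(** An ideal I that is stable across colors has linear quotients, and for an
    ideal with linear quotients a minimal free resolution can be assembled one
    generator at a time; Tor is then read off from that resolution.

    Combinatorics.  A color-squarefree monomial is identified with its set of
    variables.  Order the minimal generators by degree and, within one degree,
    by a weight that decreases whenever a variable is replaced by a larger one
    ([key]).  Both stability conditions replace a variable by a larger one
    inside I, so repeated exchanges show two things.  If a generator A comes
    before B, then some variable of A lies in [sm B] ([gens_first]); and for
    every x in [sm B] some generator before B divides x * B ([gens_swap]).
    Together they say that, for the ideal J generated by the predecessors of B,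
    the colon ideal J : B is generated by the variables in [sm B]
    ([lin_quot_gen_seq]).

    Resolutions.  For a monomial ideal J and a monomial u with Q = J : u there
    is an exact sequence 0 -> J -> J + (u) -> (P / Q)(- deg u) -> 0.  The
    horseshoe lemma builds a free resolution of the middle term out of
    resolutions of J and Q ([horseshoe], [min_res_cone]).  It is minimal as soon
    as, in each homological degree, the basis elements coming from J have total
    degree at most that of those coming from u: a unit entry would join two
    basis elements of the same degree, while every other contribution raises the
    degree.  Adding variables one by one gives the Koszul resolution of an ideal
    generated by variables ([koszul]); adding generators in the chosen order
    then contributes, for each u in G(I), one basis element of degree
    deg u + deg sigma for each subset sigma of sm u ([lin_quot_min_res]).

    Tor.  [Tor] is defined by the standard resolution, whose terms are huge.  It
    is compared with a minimal resolution through stable equivalence: two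
    modules are related when there are maps f and g between them with
    g f - 1 and f g - 1 factoring through free modules.  Passing to syzygies
    preserves this relation, whatever free covers are used
    ([stable_equiv_syz]), so every syzygy in the standard resolution is stably
    equivalent to the corresponding one in the minimal resolution.  One further
    step identifies the homology at that spot with the free module of the
    minimal resolution modulo the maximal ideal ([homology_iso],
    [tor_min_res]). *)

Set Implicit Arguments.
Unset Strict Implicit.
Unset Printing Implicit Defensive.

Import Order.TTheory GRing.Theory Num.Theory.

Local Open Scope ring_scope.

(** * Modules over a commutative ring *)

Section Modules.
Variable R : comNzRingType.

Lemma ker_factor (U V W : lmodType R) (p : {linear V -> W})
    (f : {linear U -> V}) :
  (forall x, p (f x) = 0) ->
  exists g : {linear U -> ker p}, forall x, val (g x) = f x.
Proof.
move=> pf; pose g x : ker p := Ker (introT eqP (pf x)).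
have gL : linear g by move=> a x y; apply/val_inj; rewrite /= linearP.
by exists (HB.pack_for {linear U -> ker p} g
  (GRing.isLinear.Build R U (ker p) _ g gL)).
Qed.

Lemma quot_factor (V W : lmodType R) (D : V -> Prop) (f : {linear V -> W}) :
  (forall x, D x -> f x = 0) ->
  exists g : {linear quotmod D -> W}, forall x, g (quot_proj D x) = f x.
Proof.
move=> fD; pose g (q : quotmod D) := f (repr q : V).
have gE x : g (quot_proj D x) = f x.
  apply/eqP; rewrite -subr_eq0 -linearB; apply/eqP.
  have: repr (quot_proj D x) - x \in span D.
    by apply/quot_projP; rewrite quot_proj_repr.
  by move/(@span_min _ _ _ (in_ker f) (fun y Dy => introT eqP (fD y Dy)))/eqP.
have gL : linear g.
  move=> a q r; rewrite -(quot_proj_repr q) -(quot_proj_repr r) -linearP.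
  by rewrite !gE linearP.
by exists (HB.pack_for {linear quotmod D -> W} g
  (GRing.isLinear.Build R (quotmod D) W _ g gL)).
Qed.

Section Free.
Variables (S : choiceType).
Local Notation F := {malg R[S]}.

Lemma malg_basisE (g : F) : g = \sum_(k <- msupp g) g@_k *: << k >>.
Proof.
rewrite [LHS]monalgE; apply: eq_bigr => k _; apply/malgP => l.
by rewrite mcoeffZ !mcoeffU mulrnAr mulr1.
Qed.

Lemma free_lin_eq (V : lmodType R) (f g : {linear F -> V}) :
  (forall k, f << k >> = g << k >>) -> f =1 g.
Proof.
move=> fg x; rewrite (malg_basisE x) !linear_sum.
by apply: eq_bigr => k _; rewrite !linearZ /= fg.
Qed.

(** Free modules are projective. *)
Lemma free_lift (V W : lmodType R) (p : {linear V -> W}) (f : {linear F -> W}) :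
  (forall y, exists x, p x = y) ->
  exists g : {linear F -> V}, forall x, p (g x) = f x.
Proof.
move=> ps; have [h hE] := choice (fun k => ps (f << k >>)).
exists (free_ext h) => x.
apply: (free_lin_eq (f := p \o free_ext h)) => k.
by rewrite /= free_extU.
Qed.

End Free.

Section Tensors.
Variables (M N V : lmodType R).

Lemma tensorE (t : tensor M N) :
  exists s : seq (M * N), t = \sum_(p <- s) tens p.1 p.2.
Proof.
rewrite -(quot_proj_repr t) [repr t]malg_basisE linear_sum.
exists [seq ((repr t)@_k *: k.1, k.2) | k <- msupp (repr t)].
rewrite big_map; apply: eq_bigr => -[x y] _ /=.
by rewrite tensZl linearZ.
Qed.

Lemma tensor_lift (b : M -> N -> V) :
  (forall x x' y, b (x + x') y = b x y + b x' y) ->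
  (forall x y y', b x (y + y') = b x y + b x y') ->
  (forall a x y, b (a *: x) y = a *: b x y) ->
  (forall a x y, b x (a *: y) = a *: b x y) ->
  exists f : {linear tensor M N -> V}, forall x y, f (tens x y) = b x y.
Proof.
move=> bDl bDr bZl bZr; pose f0 := free_ext (fun p : M * N => b p.1 p.2).
have [|f fE] := quot_factor (D := @tensor_rel R M N) (f := f0).
  move=> z; case=> -[a [x [y ->]]]; rewrite !linearB ?linearZ /= !free_extU /=.
  - by rewrite bDl addrAC addrK subrr.
  - by rewrite bDr addrAC addrK subrr.
  - by rewrite bZl scalerN subrr.
  - by rewrite bZr scalerN subrr.
by exists f => x y; rewrite fE; exact: free_extU.
Qed.

End Tensors.

End Modules.

(** * Graded maps, free covers and stable equivalence *)

Section Graded.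
Variables (K : fieldType) (T : finType).
Local Notation P := (polyring K T).
Local Notation k := (residue_field K T).

Definition hom_map (M N : grmod K T) (f : M -> N) :=
  forall a x, homog a x -> homog a (f x).

(** Surjectivity degree by degree: this is what makes lifts along f
    homogeneous. For a graded target it implies surjectivity. *)
Definition hom_onto (M N : grmod K T) (f : M -> N) :=
  forall a y, homog a y -> exists x, homog a x /\ f x = y.

Lemma homogD (M : grmod K T) : is_graded M ->
  forall a (x y : M), homog a x -> homog a y -> homog a (x + y).
Proof.
move=> gM a x y hx hy; rewrite -[y]opprK; apply: (homogB gM hx).
by rewrite -sub0r; exact: (homogB gM (homog0 gM a) hy).
Qed.

Lemma hom_onto_surj (M N : grmod K T) (f : {linear M -> N}) :
  is_graded N -> hom_onto f -> forall y, exists x, f x = y.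
Proof.
move=> gN fo y; have [s [g [_ gh ->]]] := homog_decomp gN y.
have [h hE] := choice (fun a => fo a _ (gh a)).
exists (\sum_(a <- s) h a); rewrite linear_sum.
by apply: eq_bigr => a _; case: (hE a).
Qed.

Lemma homog_polyC (p : gr_poly K T) : p = 1 -> homog 0 p.
Proof.
move=> -> u /(fsubsetP msuppU_le); rewrite inE => /eqP->.
by apply/ffunP => x; rewrite !ffunE cm1.
Qed.

Section Free.
Variables (S : choiceType) (dg : S -> multideg T).
Local Notation F := (gr_free K dg).

Lemma homog_basis s : homog (g := F) (dg s) << s >>.
Proof.
move=> t; rewrite mcoeffU; case: eqP => [->|_].
  by rewrite subrr; exact: homog_polyC.
by rewrite mulr0n; exact: (homog0 (gr_poly_graded K T)).
Qed.

Lemma homog_free_ext (N : grmod K T) (h : S -> N) : is_graded N ->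
  (forall s, homog (dg s) (h s)) -> hom_map (M := F) (free_ext h).
Proof.
move=> gN hh a x hx; rewrite /free_ext.
elim/big_ind: _ => [||s _]; [exact: homog0 | exact: homogD |].
by rewrite -[a](subrK (dg s)); apply: (homogZ gN); [exact: hx | exact: hh].
Qed.

Lemma free_lift_homog (M N : grmod K T) (p : {linear M -> N})
    (f : {linear F -> N}) : is_graded M -> hom_onto p -> hom_map f ->
  exists g : {linear F -> M}, hom_map g /\ forall x, p (g x) = f x.
Proof.
move=> gM po fh; have [h hE] := choice (fun s => po _ _ (fh (dg s) _ (@homog_basis s))).
exists (free_ext h); split; first by apply: homog_free_ext => // s; case: (hE s).
apply: (free_lin_eq (f := p \o free_ext h)) => s.
by rewrite /= free_extU; case: (hE s).
Qed.

End Free.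

Lemma cover_map_onto (M : grmod K T) : hom_onto (cover_map M).
Proof.
move=> a x hx; have sx : `[< homog (a, x).1 (a, x).2 >] by apply/asboolP.
exists << (Sub (a, x) sx : helt M) >>; split; last by rewrite /= free_extU.
exact: (@homog_basis _ (fun p : helt M => (val p).1) (Sub (a, x) sx)).
Qed.

Definition thru_free (M N : grmod K T) (f : M -> N) :=
  exists (S : choiceType) (a : {linear M -> {malg P[S]}})
    (b : {linear {malg P[S]} -> N}), forall x, f x = b (a x).

(** Homotopy equivalence one syzygy at a time: the free modules through which
    the two differences factor play the part of the homotopies between chain
    maps, so that no chain map has to be chosen in all degrees at once. The
    factorizations need not be homogeneous. *)
Definition stable_equiv (M N : grmod K T) :=
  exists (f : {linear M -> N}) (g : {linear N -> M}),
    [/\ hom_map f, hom_map g, thru_free (fun x => g (f x) - x)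
      & thru_free (fun y => f (g y) - y)].

Lemma stable_equiv_refl M : stable_equiv M M.
Proof.
have z : thru_free (fun x : M => x - x).
  by exists unit, \0, \0 => x; rewrite subrr.
by exists idfun, idfun; split.
Qed.

(** If g f - 1 = b a with a landing in a free module, lift b to b' along the
    cover eM; then ge fe - 1 - b' a eM takes values in ker eM, and it equals
    ge fe - 1 on ker eM. *)
Lemma syzygy_homotopy (M N : grmod K T) (S S' : choiceType)
    (dg : S -> multideg T) (dg' : S' -> multideg T)
    (eM : {linear gr_free K dg -> M}) (eN : {linear gr_free K dg' -> N})
    (f : {linear M -> N}) (g : {linear N -> M})
    (fe : {linear gr_free K dg -> gr_free K dg'})
    (ge : {linear gr_free K dg' -> gr_free K dg}) :
  is_graded M -> hom_onto eM ->
  (forall x, eN (fe x) = f (eM x)) -> (forall y, eM (ge y) = g (eN y)) ->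
  thru_free (fun x => g (f x) - x) ->
  exists s : {linear gr_free K dg -> gr_ker eM},
    forall x, eM x = 0 -> val (s x) = ge (fe x) - x.
Proof.
move=> gM oM feE geE [Q [a [b abE]]].
have [b' b'E] := free_lift b (hom_onto_surj gM oM).
pose s0 := (ge \o fe \- idfun \- (b' \o a \o eM)) : {linear gr_free K dg -> gr_free K dg}.
have [x|s sE] := ker_factor (p := eM) (f := s0).
  by rewrite !linearB /= geE feE b'E -abE subrr.
exists s => x x0; by rewrite sE /= x0 (linear0 a) (linear0 b') subr0.
Qed.

Lemma ker_map (M N : grmod K T) (S S' : choiceType)
    (dg : S -> multideg T) (dg' : S' -> multideg T)
    (eM : {linear gr_free K dg -> M}) (eN : {linear gr_free K dg' -> N})
    (f : {linear M -> N}) (fe : {linear gr_free K dg -> gr_free K dg'}) :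
  (forall x, eN (fe x) = f (eM x)) -> hom_map fe ->
  exists f' : {linear gr_ker eM -> gr_ker eN},
    hom_map f' /\ forall x, val (f' x) = fe (val x).
Proof.
move=> feE fh; have [x|f' f'E] := ker_factor (p := eN)
    (f := fe \o val : {linear gr_ker eM -> gr_free K dg'}).
  by rewrite /= feE ker_valP linear0.
exists f'; split=> // a x hx; rewrite /= f'E; exact: fh.
Qed.

(** Besides the stable equivalence of the kernels, the conclusion keeps that g
    extends to the covers and that the new free modules are the covers
    themselves: the computation of homology below uses both. *)
Lemma stable_equiv_syz (M N : grmod K T) (S S' : choiceType)
    (dg : S -> multideg T) (dg' : S' -> multideg T)
    (eM : {linear gr_free K dg -> M}) (eN : {linear gr_free K dg' -> N}) :
  is_graded M -> is_graded N -> hom_map eM -> hom_map eN ->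
  hom_onto eM -> hom_onto eN -> stable_equiv M N ->
  exists (f : {linear gr_ker eM -> gr_ker eN})
    (g : {linear gr_ker eN -> gr_ker eM})
    (ge : {linear gr_free K dg' -> gr_free K dg})
    (s : {linear gr_free K dg -> gr_ker eM})
    (t : {linear gr_free K dg' -> gr_ker eN}),
  [/\ hom_map f, hom_map g, forall y, val (g y) = ge (val y),
      forall x, g (f x) - x = s (val x) & forall y, f (g y) - y = t (val y)].
Proof.
move=> gM gN hM hN oM oN [f [g [fh gh gf fg]]].
have gF := gr_free_graded.
have [|fe [feh feE]] := free_lift_homog (f := f \o eM) (gF _ _ _ dg') oN.
  by move=> a x /hM /fh.
have [|ge [geh geE]] := free_lift_homog (f := g \o eN) (gF _ _ _ dg) oM.
  by move=> a x /hN /gh.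
have [f' [f'h f'E]] := ker_map feE feh.
have [g' [g'h g'E]] := ker_map geE geh.
have [s sE] := syzygy_homotopy gM oM feE geE gf.
have [t tE] := syzygy_homotopy gN oN geE feE fg.
exists f', g', ge, s, t; split=> // [x|y]; apply/val_inj.
  by rewrite sE ?ker_valP //= g'E f'E.
by rewrite tE ?ker_valP //= f'E g'E.
Qed.

Corollary stable_equiv_ker (M N : grmod K T) (S S' : choiceType)
    (dg : S -> multideg T) (dg' : S' -> multideg T)
    (eM : {linear gr_free K dg -> M}) (eN : {linear gr_free K dg' -> N}) :
  is_graded M -> is_graded N -> hom_map eM -> hom_map eN ->
  hom_onto eM -> hom_onto eN -> stable_equiv M N ->
  stable_equiv (gr_ker eM) (gr_ker eN).
Proof.
move=> gM gN hM hN oM oN MN.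
have [f [g [ge [s [t [fh gh _ sE tE]]]]]] :=
  stable_equiv_syz gM gN hM hN oM oN MN.
exists f, g; split=> //.
  by exists S, (val : {linear gr_ker eM -> gr_free K dg}), s.
by exists S', (val : {linear gr_ker eN -> gr_free K dg'}), t.
Qed.

End Graded.

(** * The residue field and the maximal ideal *)

Section Residue.
Variables (K : fieldType) (T : finType).
Local Notation P := (polyring K T).
Local Notation k := (residue_field K T).

Lemma malgU_mul (c : K) (u v : {cmonom T}) :
  << c *g mmul u v >> = << c *g u >> * << v >> :> {malg K[{cmonom T}]}.
Proof. by rewrite malgM_def fgmulUU mulr1. Qed.

Definition const_coef (p : P) : K := p@_mone.

Lemma const_coefM p q : const_coef (p * q) = const_coef p * const_coef q.
Proof. exact: (rmorphM (mcoeff mone : {rmorphism P -> K})). Qed.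

Lemma const_coef_homog a (p : gr_poly K T) :
  homog a p -> const_coef p != 0 -> a = 0.
Proof.
rewrite /const_coef mcoeff_neq0 => hp /hp <-.
by apply/ffunP => x; rewrite !ffunE cm1.
Qed.

Section Free.
Variables (S : choiceType) (dg : S -> multideg T).

(** x lies in mF, where m is the ideal generated by the variables. *)
Definition in_max (x : gr_free K dg) :=
  forall s, const_coef (x : {malg P[S]})@_s = 0.

Lemma in_max0 : in_max 0.
Proof. by move=> s; rewrite mcoeff0 /const_coef mcoeff0. Qed.

Lemma in_maxD x y : in_max x -> in_max y -> in_max (x + y).
Proof.
by move=> hx hy s; rewrite mcoeffD /const_coef mcoeffD [_@_mone]hx [_@_mone]hy addr0.
Qed.

Lemma in_maxZ (p : P) x : const_coef p = 0 -> in_max (p *: x).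
Proof. by move=> p0 s; rewrite mcoeffZ const_coefM p0 mul0r. Qed.

Lemma in_max_sum (J : Type) (s : seq J) (f : J -> gr_free K dg) :
  (forall j, in_max (f j)) -> in_max (\sum_(j <- s) f j).
Proof.
by move=> hf; elim/big_ind: _ => //; [exact: in_max0 | exact: in_maxD].
Qed.

End Free.

Lemma in_max_map (S S' : choiceType) (dg : S -> multideg T)
    (dg' : S' -> multideg T) (f : {linear gr_free K dg -> gr_free K dg'}) x :
  in_max x -> in_max (f x).
Proof.
move=> hx; rewrite (malg_basisE x) linear_sum; apply: in_max_sum => s.
by rewrite linearZ; exact/in_maxZ/hx.
Qed.

(** The kernel is graded, so it is enough to look at homogeneous elements. *)
Lemma in_max_ker (S : choiceType) (dg : S -> multideg T) (M : grmod K T)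
    (e : {linear gr_free K dg -> M}) : is_graded M -> hom_map e ->
  (forall a y, homog a y -> e y = 0 -> in_max y) ->
  forall y, e y = 0 -> in_max y.
Proof.
move=> gM he em y y0; have gK := gr_ker_graded (gr_free_graded K dg) gM he.
have [s [f [_ fh yE]]] := homog_decomp gK (Ker (introT eqP y0)).
have -> : y = \sum_(a <- s) val (f a) by have /(congr1 val) := yE; rewrite raddf_sum.
apply: in_max_sum => a; apply: (em a); first exact: fh.
exact: ker_valP.
Qed.

(** Every monomial other than 1 is divisible by a variable. *)
Lemma max_scale (p : P) (c : k) : const_coef p = 0 -> p *: c = 0.
Proof.
move=> p0; rewrite -(quot_proj_repr c) -linearZ; apply/quot_proj0.
rewrite [p]monalgE scaler_suml big_seq; apply: rpred_sum => u pu.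
have [x ux] : exists x, (0 < u x)%N.
  apply/not_existsP => u0; have u1 : u = mone.
    by apply/eqP/cmP => x; rewrite cm1; apply/eqP; rewrite -leqn0 leqNgt; apply/negP/u0.
  by move: pu; rewrite u1 -mcoeff_neq0 [_@__]p0 eqxx.
have uE : u = mmul (divcm u (ucm x)) (ucm x).
  apply/eqP/cmP => y; rewrite cmM divcmE cmU subnK //.
  by case: eqP => // <-.
rewrite uE malgU_mul -uE.
have -> : (<< p@_u *g divcm u (ucm x) >> * << ucm x >> : P)
    *: (repr c : gr_poly K T) =
  (<< p@_u *g divcm u (ucm x) >> * (repr c : P)) *: (mono K (ucm x) : gr_poly K T).
  exact: mulrAC.
by apply: rpredZ; apply: mem_span; exists x.
Qed.

(** mF (x) k = F (x) mk = 0. *)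
Lemma tens_in_max (S : choiceType) (dg : S -> multideg T) (x : gr_free K dg)
    (c : k) : in_max x -> tens x c = 0.
Proof.
move=> hx; rewrite (malg_basisE x).
have tens_suml (r : seq S) (f : S -> gr_free K dg) :
    tens (\sum_(s <- r) f s) c = \sum_(s <- r) tens (f s) c.
  elim: r => [|s r IHr]; last by rewrite !big_cons tensDl IHr.
  by rewrite !big_nil -[X in tens X](scale0r (0 : gr_free K dg)) tensZl scale0r.
rewrite tens_suml big1 // => s _; rewrite tensZl -tensZr.
by rewrite (max_scale _ (hx s)) -[X in tens _ X](scale0r (0 : k)) tensZr scale0r.
Qed.

Lemma res_homog0 a : homog (g := k) a 0.
Proof. by exists 0; rewrite ?linear0 //; exact: (homog0 (gr_poly_graded K T)). Qed.

Lemma res_homogD a (c d : k) : homog a c -> homog a d -> homog a (c + d).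
Proof.
move=> [x hx <-] [y hy <-]; exists (x + y); last by rewrite linearD.
exact: (homogD (gr_poly_graded K T)).
Qed.

Lemma res_homogZ a b (p : gr_poly K T) (c : k) :
  homog a p -> homog b c -> homog (a + b) ((p : P) *: c).
Proof.
move=> hp [x hx <-]; exists ((p : P) *: x); last by rewrite linearZ.
exact: homog_polyM.
Qed.

End Residue.

(** * Homology computed from a minimal cover *)

Section TorOne.
Variables (K : fieldType) (T : finType).
Local Notation P := (polyring K T).
Local Notation k := (residue_field K T).

Section Iso.
Variables M N : grmod K T.

Lemma graded_iso_of_onto (f : {linear M -> N}) :
  injective f -> (forall y, exists x, f x = y) ->
  (forall a x, homog a x <-> homog a (f x)) -> graded_iso M N.
Proof.
move=> fi fs fh; have [g gK] := choice fs.
by exists f; split=> //; exists g => // x; apply: fi; rewrite gK.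
Qed.

Lemma graded_iso_sym : graded_iso M N -> graded_iso N M.
Proof.
move=> [f [[g fK gK] fh]].
have gL : linear g by move=> a x y; rewrite -{1}[x]gK -{1}[y]gK -linearP fK.
exists (HB.pack_for {linear N -> M} g (GRing.isLinear.Build P N M _ g gL)).
by split=> [|a x]; [exists f | rewrite fh /= gK].
Qed.

End Iso.

Lemma graded_iso_trans (M N Q : grmod K T) :
  graded_iso M N -> graded_iso N Q -> graded_iso M Q.
Proof.
move=> [f [fb fh]] [g [gb gh]]; exists (g \o f); split; first exact: bij_comp.
by move=> a x; rewrite fh gh.
Qed.

Lemma sum_shift_reindex (I J : finType) (b : I -> multideg T)
    (c : J -> multideg T) (h : I -> J) (M : grmod K T) :
  bijective h -> (forall i, c (h i) = b i) ->
  graded_iso (gr_sum_shift c M) (gr_sum_shift b M).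
Proof.
move=> [h' hK h'K] cb.
pose f (x : gr_sum_shift c M) : gr_sum_shift b M := [ffun i => x (h i)].
pose g (y : gr_sum_shift b M) : gr_sum_shift c M := [ffun j => y (h' j)].
have fL : linear f by move=> a x y; apply/ffunP => i; rewrite !ffunE.
exists (HB.pack_for {linear gr_sum_shift c M -> gr_sum_shift b M} f
  (GRing.isLinear.Build P _ _ _ f fL)); split.
  exists g => x;
  by apply/ffunP => i; rewrite !ffunE ?h'K ?hK.
move=> a x; split=> [hx i|hx j]; first by rewrite ffunE -cb; exact: hx.
by have := hx (h' j); rewrite ffunE -cb h'K.
Qed.

Lemma tensBl (M N : lmodType P) (x y : M) (c : N) :
  tens (x - y) c = tens x c - tens y c.
Proof. by apply/eqP; rewrite eq_sym subr_eq -tensDl subrK. Qed.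

Lemma tens_suml (M N : lmodType P) (J : Type) (r : seq J) (f : J -> M) (c : N) :
  tens (\sum_(j <- r) f j) c = \sum_(j <- r) tens (f j) c.
Proof.
elim: r => [|j r IHr]; last by rewrite !big_cons tensDl IHr.
by rewrite !big_nil -[X in tens X](scale0r (0 : M)) tensZl scale0r.
Qed.

Lemma malg_basis_sum (S : finType) (g : {malg P[S]}) :
  g = \sum_s g@_s *: << s >>.
Proof.
apply/malgP => t; rewrite raddf_sum (bigD1 t) //= big1 ?addr0 => [|s st].
  by rewrite mcoeffZ mcoeffUU mulr1.
by rewrite mcoeffZ mcoeffU (negPf st) mulr0.
Qed.

Lemma tensor_coef (M V : lmodType P) (S : finType)
    (f : {linear M -> {malg P[S]}}) :
  exists h : {linear tensor M V -> {ffun S -> V}},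
    forall x c, h (tens x c) = [ffun u => (f x)@_u *: c].
Proof.
have [||||h hE] := @tensor_lift P M V {ffun S -> V}
  (fun x c => [ffun u => (f x)@_u *: c]).
- by move=> x x' c; apply/ffunP => u; rewrite !ffunE linearD mcoeffD scalerDl.
- by move=> x c c'; apply/ffunP => u; rewrite !ffunE scalerDr.
- by move=> a x c; apply/ffunP => u; rewrite !ffunE linearZ mcoeffZ scalerA.
- by move=> a x c; apply/ffunP => u; rewrite !ffunE !scalerA mulrC.
by exists h.
Qed.

Lemma gr_tensor_map_tens (M M' N : grmod K T) (f : {linear M -> M'}) x y :
  gr_tensor_map N f (tens x y) = tens (f x) y.
Proof. exact: tensor_map_tens. Qed.

(** The maps R1 (x) k -> F / mF and F / mF -> R1 (x) k induced by fl and gl,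
    with F the free module on S1, are inverse to each other on homology:
    fl gl = 1 modulo m, whereas gl fl - 1 is a boundary plus sl d0, and sl d0
    vanishes on cycles. The last two hypotheses say that gl lands in the cycles
    and that fl kills the boundaries. *)
Lemma homology_iso (R2 R1 R0 : grmod K T) (d1 : {linear R2 -> R1})
    (d0 : {linear R1 -> R0}) (S1 : finType) (dg1 : S1 -> multideg T)
    (fl : {linear R1 -> gr_free K dg1}) (gl : {linear gr_free K dg1 -> R1})
    (sl : {linear R0 -> R1}) :
  hom_map fl -> hom_map gl ->
  (forall x, in_max (fl (gl x) - x)) ->
  (forall x, exists y, d1 y = gl (fl x) - x - sl (d0 x)) ->
  (forall x (c : k), tens (d0 (gl x)) c = 0) ->
  (forall y, in_max (fl (d1 y))) ->
  graded_iso (gr_homology (gr_tensor_map k d1) (gr_tensor_map k d0))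
             (gr_sum_shift dg1 k).
Proof.
move=> flh glh fgl gfl dgl fld.
have [phi phiE] := tensor_coef k fl.
pose psi (c : gr_sum_shift dg1 k) : gr_tensor R1 k :=
  \sum_u tens (gl << u >>) (c u).
have psiL : linear psi.
  move=> a x y; rewrite /psi scaler_sumr -big_split; apply: eq_bigr => u _ /=.
  by rewrite !ffunE tensDr tensZr.
pose Psi0 := HB.pack_for {linear gr_sum_shift dg1 k -> gr_tensor R1 k} psi
  (GRing.isLinear.Build P _ _ _ psi psiL).
have phipsi c : phi (psi c) = c.
  apply/ffunP => u; rewrite linear_sum sum_ffunE (bigD1 u) //= big1 ?addr0 => [|v vu].
    rewrite phiE ffunE -[fl _](subrK << u >>) mcoeffD scalerDl.
    by rewrite (max_scale _ (fgl _ _)) add0r mcoeffUU scale1r.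
  rewrite phiE ffunE -[fl _](subrK << v >>) mcoeffD scalerDl.
  by rewrite (max_scale _ (fgl _ _)) add0r mcoeffU (negPf vu) scale0r.
have psi_ker c : gr_tensor_map k d0 (psi c) = 0.
  by rewrite linear_sum big1 // => u _; rewrite gr_tensor_map_tens.
have phi_im x : phi (gr_tensor_map k d1 x) = 0.
  have [r ->] := tensorE x.
  rewrite (linear_sum (gr_tensor_map k d1)) (linear_sum phi) big1 // => p _.
  apply/ffunP => u; rewrite gr_tensor_map_tens phiE !ffunE.
  exact/max_scale/fld.
have psiphi z : gr_tensor_map k d0 z = 0 ->
    exists x, gr_tensor_map k d1 x = psi (phi z) - z.
  have [r ->] := tensorE z => z0.
  have [y yE] := choice (fun p : R1 * k => gfl p.1).
  exists (\sum_(p <- r) tens (y p) p.2).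
  transitivity (psi (phi (\sum_(p <- r) tens p.1 p.2)) - (\sum_(p <- r) tens p.1 p.2)
    - gr_tensor_map k sl (gr_tensor_map k d0 (\sum_(p <- r) tens p.1 p.2))); last first.
    by rewrite z0 linear0 subr0.
  rewrite (linear_sum (gr_tensor_map k d1)) (linear_sum (gr_tensor_map k d0)).
  rewrite (linear_sum (gr_tensor_map k sl)) (linear_sum phi) [psi _](linear_sum Psi0).
  rewrite -!sumrB.
  apply: eq_bigr => p _; rewrite !gr_tensor_map_tens yE phiE.
  rewrite !tensBl; congr (_ - _ - _).
  have -> : gl (fl p.1) = \sum_u (fl p.1 : {malg P[S1]})@_u *: gl << u >>.
    rewrite {1}(malg_basis_sum (fl p.1)) linear_sum.
    by apply: eq_bigr => u _; rewrite linearZ.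
  rewrite tens_suml; apply: eq_bigr => u _.
  by rewrite ffunE tensZl tensZr.
have [G GE] := ker_factor (p := gr_tensor_map k d0) (f := Psi0) psi_ker.
pose W := fun z : gr_ker (gr_tensor_map k d0) =>
  exists x, gr_tensor_map k d1 x = val z.
pose kv : {linear gr_ker (gr_tensor_map k d0) -> gr_tensor R1 k} := val.
pose pv : {linear gr_ker (gr_tensor_map k d0) -> {ffun S1 -> k}} := phi \o kv.
have kvG c : kv (G c) = psi c by exact: GE.
have phiW : {subset span W <= in_ker pv}.
  by apply: span_min => y [x xE]; apply/eqP; rewrite -[RHS](phi_im x) xE.
have phi_rep c z : quot_proj W (G c) = quot_proj W z -> phi (val z) = c.
  move/quot_projP/phiW; rewrite unfold_in linearB subr_eq0 => /eqP zE.
  by rewrite -[LHS]zE -[RHS]phipsi -kvG.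
pose Psi : {linear gr_sum_shift dg1 k ->
  gr_homology (gr_tensor_map k d1) (gr_tensor_map k d0)} := quot_proj W \o G.
apply: graded_iso_sym; apply: (graded_iso_of_onto (f := Psi)).
- by move=> c c' /= /phi_rep <-; rewrite [\val _]kvG phipsi.
- move=> q; rewrite -(quot_proj_repr q); exists (phi (val (repr q))).
  apply/quot_projP; apply: mem_span.
  by have [x xE] := psiphi _ (ker_valP (repr q)); exists x; rewrite xE -kvG -(linearB kv).
move=> a c; split.
  move=> hc; exists (G c) => //; rewrite /= [\val _]kvG.
  exists [seq (gl << u >>, c u) | u <- index_enum S1]; last by rewrite big_map.
  move=> _ /mapP[u _ ->]; exists (dg1 u); last exact: hc.
  exact: (glh (dg1 u) _ (@homog_basis K T S1 dg1 u)).
case=> z [r rh zE] /esym/phi_rep <- u; rewrite zE linear_sum sum_ffunE.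
elim: r rh {zE} => [|p r IHr] rh; first by rewrite big_nil; exact: res_homog0.
rewrite big_cons; apply: res_homogD; last first.
  by apply: IHr => q qr; apply: rh; rewrite inE qr orbT.
have [|b hb hp] := rh p; first by rewrite inE eqxx.
rewrite phiE ffunE; have -> : a - dg1 u = (b - dg1 u) + (a - b).
  by rewrite [RHS]addrC addrA subrK.
exact: res_homogZ (flh _ _ hb u) hp.
Qed.

Definition min_cover (S : choiceType) (dg : S -> multideg T) (M : grmod K T)
    (e : {linear gr_free K dg -> M}) :=
  [/\ hom_map e, hom_onto e & forall a y, homog a y -> e y = 0 -> in_max y].

(** The hypotheses of [homology_iso] follow from the stable equivalence of M
    and N. The minimality of e0 and e1 makes all error terms vanish modulo m:
    they are either in the kernel of e1 or images of elements of the kernel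
    of e0. *)
Lemma homology_iso_min (M N : grmod K T) (S R S0 : choiceType) (S1 : finType)
    (dS : S -> multideg T) (dR : R -> multideg T)
    (eM : {linear gr_free K dS -> M})
    (eR : {linear gr_free K dR -> gr_ker eM})
    (dg0 : S0 -> multideg T) (dg1 : S1 -> multideg T)
    (e0 : {linear gr_free K dg0 -> N})
    (e1 : {linear gr_free K dg1 -> gr_ker e0})
    (Q : grmod K T) (d1 : {linear Q -> gr_free K dR})
    (d0 : {linear gr_free K dR -> gr_free K dS}) :
  (forall x, d0 x = 0 <-> exists y, d1 y = x) ->
  (forall x, d0 x = val (eR x)) ->
  is_graded M -> is_graded N -> stable_equiv M N ->
  hom_map eM -> hom_onto eM -> hom_map eR -> hom_onto eR ->
  hom_map e0 -> hom_onto e0 ->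
  (forall a y, homog a y -> e0 y = 0 -> in_max y) ->
  hom_map e1 -> hom_onto e1 ->
  (forall a y, homog a y -> e1 y = 0 -> in_max y) ->
  graded_iso (gr_homology (gr_tensor_map k d1) (gr_tensor_map k d0))
    (gr_sum_shift dg1 k).
Proof.
move=> d1E d0E gM gN MN hM oM hR oR h0 o0 m0 h1 o1 m1.
have gF := gr_free_graded.
have gK := gr_ker_graded (gF _ _ _ _) gM hM.
have gN1 := gr_ker_graded (gF _ _ _ _) gN h0.
have {}m0 := in_max_ker gN h0 m0; have {}m1 := in_max_ker gN1 h1 m1.
have [f [g [ge [s [t [fh gh geE sE tE]]]]]] :=
  stable_equiv_syz gM gN hM h0 oM o0 MN.
have [|fl [flh flE]] := free_lift_homog (f := f \o eR) (gF _ _ _ dg1) o1.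
  by move=> a x /hR /fh.
have [|gl [glh glE]] := free_lift_homog (f := g \o e1) (gF _ _ _ dR) oR.
  by move=> a x /h1 /gh.
have {}flE x : e1 (fl x) = f (eR x) by exact: flE.
have {}glE x : eR (gl x) = g (e1 x) by exact: glE.
have [sl slE] := free_lift s (hom_onto_surj gK oR).
have [tl tlE] := free_lift t (hom_onto_surj gN1 o1).
refine (@homology_iso Q (gr_free K dR) (gr_free K dS) d1 d0 _ _ fl gl sl
  flh glh _ _ _ _).
- move=> x.
  have -> : fl (gl x) - x = (fl (gl x) - x - tl (val (e1 x))) + tl (val (e1 x)).
    by rewrite subrK.
  apply: in_maxD; last by apply: in_max_map; apply: m0; exact: ker_valP.
  by apply: m1; rewrite !linearB flE glE tE tlE subrr.
- move=> x.
  apply/d1E; rewrite d0E; apply: (congr1 val (_ : _ = 0)).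
  by rewrite !linearB glE flE sE slE d0E subrr.
- move=> x c; apply: tens_in_max; rewrite d0E glE geE.
  by apply: in_max_map; apply: m0; exact: ker_valP.
move=> y; apply: m1; rewrite flE.
have /d1E : exists z, d1 z = d1 y by exists y.
by rewrite d0E => /(@val_inj _ _ _ _ 0) ->; rewrite linear0.
Qed.

Lemma tor_min_cover n (M N : grmod K T) (S0 : choiceType) (S1 : finType)
    (dg0 : S0 -> multideg T) (dg1 : S1 -> multideg T)
    (e0 : {linear gr_free K dg0 -> N})
    (e1 : {linear gr_free K dg1 -> gr_ker e0}) :
  is_graded M -> is_graded N -> stable_equiv (iter n (@syz K T) M) N ->
  min_cover e0 -> min_cover e1 ->
  graded_iso (Tor n.+1 M k) (gr_sum_shift dg1 k).
Proof.
move=> gM gN MN [h0 o0 m0] [h1 o1 m1].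
pose L := iter n (@syz K T) M.
have gL : is_graded L := syz_graded n gM.
have gsL : is_graded (syz L) := syz_graded n.+1 gM.
have dE x : res_d M n x = val (cover_map (syz L) x) by [].
have H := @homology_iso_min L N _ _ _ _
  (fun p : helt L => (val p).1) (fun p : helt (syz L) => (val p).1)
  (cover_map L) (cover_map (syz L)) _ _ e0 e1
  (res M n.+2) (res_d M n.+1) (res_d M n) (res_exact gM) dE.
exact: (H gL gN MN (cover_map_homog gL) (@cover_map_onto _ _ L)
  (cover_map_homog gsL) (@cover_map_onto _ _ (syz L)) h0 o0 m0 h1 o1 m1).
Qed.

End TorOne.

(** * Minimal graded free resolutions *)

Section MinRes.
Variables (K : fieldType) (T : finType).
Local Notation P := (polyring K T).
Local Notation k := (residue_field K T).
Local Notation degrees S := (forall i : nat, S i -> multideg T).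

(** The first n steps of a minimal graded free resolution of M, whose l-th term
    has the basis S l with degrees dg l. Working with syzygy modules instead of
    a complex lets proofs go by induction on n. *)
Fixpoint min_res n (M : grmod K T) (S : nat -> finType) (dg : degrees S) : Prop :=
  if n is n'.+1 then
    exists e : {linear gr_free K (dg 0) -> M},
      min_cover e /\ min_res n' (gr_ker e) (fun i => dg i.+1)
  else True.

Lemma stable_equiv_min_res n (M N : grmod K T) (S : nat -> finType)
    (dg : degrees S) :
  is_graded M -> is_graded N -> stable_equiv M N -> min_res n.+2 N dg ->
  exists (N' : grmod K T) (S' : choiceType) (dg' : S' -> multideg T)
    (e0 : {linear gr_free K dg' -> N'})
    (e1 : {linear gr_free K (dg n.+1) -> gr_ker e0}),
    [/\ is_graded N', stable_equiv (iter n (@syz K T) M) N', min_cover e0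
      & min_cover e1].
Proof.
elim: n M N S dg => [|n IHn] M N S dg gM gN MN [e0 [m0 rN]].
  by case: rN => e1 [m1 _]; exists N, (S 0%N), (dg 0%N), e0, e1.
have [h0 o0 _] := m0.
rewrite iterSr; apply: (IHn _ (gr_ker e0) _ (fun i => dg i.+1)) => //.
- exact: (syz_graded 1 gM).
- exact: gr_ker_graded (gr_free_graded K (dg 0%N)) gN h0.
exact: (@stable_equiv_ker _ _ M N _ _ (fun p : helt M => (val p).1) _ (cover_map M)
  e0 gM gN (cover_map_homog gM) h0 (@cover_map_onto _ _ M) o0 MN).
Qed.

Theorem tor_min_res n (M : grmod K T) (S : nat -> finType) (dg : degrees S) :
  is_graded M -> min_res n.+2 M dg ->
  graded_iso (Tor n.+1 M k) (gr_sum_shift (dg n.+1) k).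
Proof.
move=> gM rM.
have [N [S' [dg' [e0 [e1 [gN MN m0 m1]]]]]] :=
  stable_equiv_min_res gM gM (stable_equiv_refl M) rM.
exact: tor_min_cover gM gN MN m0 m1.
Qed.

Lemma min_res_zero n (M : grmod K T) (S : nat -> finType) (dg : degrees S) :
  is_graded M -> (forall x : M, x = 0) -> (forall i, S i -> False) ->
  min_res n M dg.
Proof.
elim: n M S dg => //= n IHn M S dg gM M0 S0.
have F0 (x : gr_free K (dg 0%N)) : x = 0 by apply/malgP => s; case: (S0 _ s).
pose e : {linear gr_free K (dg 0%N) -> M} := free_ext (fun=> 0).
have eh : hom_map e by move=> a x _; rewrite (M0 (e x)); exact: homog0.
exists e; split; last first.
  apply: IHn => [|x|i]; last exact: S0.
    exact: gr_ker_graded (gr_free_graded K (dg 0%N)) gM eh.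
  exact/val_inj/F0.
split=> // [a y _|a y _ _ s]; last by case: (S0 _ s).
exists 0; split; first exact: (homog0 (gr_free_graded K (dg 0%N))).
by rewrite (M0 y) linear0.
Qed.

Section SumBasis.
Variables (S1 S2 : choiceType) (dg1 : S1 -> multideg T) (dg2 : S2 -> multideg T).

Definition sum_deg (s : S1 + S2) : multideg T :=
  match s with inl s => dg1 s | inr s => dg2 s end.

Local Notation F := (gr_free K sum_deg).
Local Notation F1 := (gr_free K dg1).
Local Notation F2 := (gr_free K dg2).

Definition free_inl : {linear F1 -> F} := free_ext (fun s => << inl s >>).
Definition free_inr : {linear F2 -> F} := free_ext (fun s => << inr s >>).
Definition free_prl : {linear F -> F1} :=
  free_ext (fun s => match s with inl s => << s >> | inr _ => 0 end).
Definition free_prr : {linear F -> F2} :=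
  free_ext (fun s => match s with inl _ => 0 | inr s => << s >> end).

Lemma free_inlK x : free_prl (free_inl x) = x.
Proof.
apply: (free_lin_eq (f := free_prl \o free_inl) (g := idfun)) => s.
by rewrite /= !free_extU.
Qed.

Lemma free_inrK x : free_prr (free_inr x) = x.
Proof.
apply: (free_lin_eq (f := free_prr \o free_inr) (g := idfun)) => s.
by rewrite /= !free_extU.
Qed.

Lemma free_prr_inl x : free_prr (free_inl x) = 0.
Proof.
apply: (free_lin_eq (f := free_prr \o free_inl) (g := \0)) => s.
by rewrite /= !free_extU.
Qed.

Lemma free_prl_inr x : free_prl (free_inr x) = 0.
Proof.
apply: (free_lin_eq (f := free_prl \o free_inr) (g := \0)) => s.
by rewrite /= !free_extU.
Qed.

Lemma free_sumE x : x = free_inl (free_prl x) + free_inr (free_prr x).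
Proof.
apply: (free_lin_eq (f := idfun)
  (g := (free_inl \o free_prl) \+ (free_inr \o free_prr))) => -[s|s];
by rewrite /= !free_extU ?linear0 ?free_extU ?addr0 ?add0r.
Qed.

Lemma homog_inl : hom_map free_inl.
Proof.
apply: homog_free_ext (gr_free_graded K sum_deg) _ => s.
exact: (@homog_basis K T _ sum_deg (inl s)).
Qed.

Lemma homog_inr : hom_map free_inr.
Proof.
apply: homog_free_ext (gr_free_graded K sum_deg) _ => s.
exact: (@homog_basis K T _ sum_deg (inr s)).
Qed.

Lemma homog_prl : hom_map free_prl.
Proof.
apply: homog_free_ext (gr_free_graded K dg1) _ => -[s|s].
  exact: (@homog_basis K T _ dg1 s).
exact: (homog0 (gr_free_graded K dg1)).
Qed.

Lemma homog_prr : hom_map free_prr.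
Proof.
apply: homog_free_ext (gr_free_graded K dg2) _ => -[s|s].
  exact: (homog0 (gr_free_graded K dg2)).
exact: (@homog_basis K T _ dg2 s).
Qed.

Lemma in_max_sumP x : in_max (free_prl x) -> in_max (free_prr x) -> in_max x.
Proof.
by move=> hl hr; rewrite [x]free_sumE; apply: in_maxD; apply: in_max_map.
Qed.

End SumBasis.

Definition tdeg (a : multideg T) : int := \sum_x a x.

Lemma tdegB a b : tdeg (a - b) = tdeg a - tdeg b.
Proof. by rewrite /tdeg -sumrB; apply: eq_bigr => x _; rewrite !ffunE. Qed.

Lemma tdeg_deg_gt0 (u : {cmonom T}) : u != mone -> 0 < tdeg (deg u).
Proof.
move=> u1; have [x ux] : exists x, (0 < u x)%N.
  apply/not_existsP => u0; case/eqP: u1; apply/eqP/cmP => x; rewrite cm1.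
  by apply/eqP; rewrite -leqn0 leqNgt; apply/negP/u0.
rewrite /tdeg (bigD1 x) //= ffunE ltr_wpDr ?ltz_nat //.
by apply: sumr_ge0 => y _; rewrite ffunE.
Qed.

(** The exact sequence 0 -> X -> Y -> Z -> 0 is given without Z: the first
    module F of the resolution of Z already maps to Y by w, and N is the first
    syzygy of Z, that is, the inverse image of X in F. In this form the kernel
    of the cover of Y is again such an extension, of the syzygy of N by the
    syzygy of X, so the induction closes. The inequality on total degrees is
    what keeps the resolution minimal. *)
Lemma horseshoe n (X Y N : grmod K T) (S R : nat -> finType) (dS : degrees S)
    (dR : degrees R) (i : {linear X -> Y}) (w : {linear gr_free K (dR 0%N) -> Y})
    (j : {linear N -> gr_free K (dR 0%N)}) :
  is_graded Y -> injective i -> (forall a x, homog a x <-> homog a (i x)) ->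
  hom_map w ->
  (forall a y, homog a y -> exists x f, [/\ homog a x, homog a f & y = i x + w f]) ->
  injective j -> (forall a z, homog a z <-> homog a (j z)) ->
  (forall f, (exists x, w f = i x) <-> exists z, f = j z) ->
  (forall a z, homog a z -> in_max (j z)) ->
  (forall l s t, tdeg (dS l s) <= tdeg (dR l t)) ->
  min_res n X dS -> min_res n N (fun l => dR l.+1) ->
  min_res n Y (S := fun l => (S l + R l)%type) (fun l => sum_deg (dS l) (dR l)).
Proof.
elim: n X Y N S R dS dR i w j => // n IHn X Y N S R dS dR i w j gY ii ih wh cov
  ji jh jN jm wt [eX [[hX oX mX] rX]] [eN [[hN oN mN] rN]].
pose F := gr_free K (sum_deg (dS 0%N) (dR 0%N)).
pose pl : {linear F -> gr_free K (dS 0%N)} := free_prl (dS 0%N) (dR 0%N).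
pose pr : {linear F -> gr_free K (dR 0%N)} := free_prr (dS 0%N) (dR 0%N).
pose il : {linear gr_free K (dS 0%N) -> F} := free_inl (dS 0%N) (dR 0%N).
pose ir : {linear gr_free K (dR 0%N) -> F} := free_inr (dS 0%N) (dR 0%N).
have plil x : pl (il x) = x by exact: free_inlK.
have plir x : pl (ir x) = 0 by exact: free_prl_inr.
have pril x : pr (il x) = 0 by exact: free_prr_inl.
have FE y : y = il (pl y) + ir (pr y) by exact: free_sumE.
have prir x : pr (ir x) = x by exact: free_inrK.
pose e : {linear F -> Y} := (i \o eX \o pl) \+ (w \o pr).
have eE y : e y = i (eX (pl y)) + w (pr y) by [].
have eh : hom_map e.
  move=> a y hy; rewrite eE; apply: (homogD gY).
    by apply/ih/hX; exact: homog_prl.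
  by apply: wh; exact: homog_prr.
have gK : is_graded (gr_ker e) := gr_ker_graded (gr_free_graded K _) gY eh.
exists e; split.
  split=> // [a y /cov[x [f [hx hf ->]]]|a y hy y0].
    have [g [hg gx]] := oX a x hx; exists (il g + ir f); split.
      apply: (homogD (gr_free_graded K _)); first exact: homog_inl.
      exact: homog_inr.
    by rewrite eE (linearD pl) (linearD pr) plil plir pril prir addr0 add0r gx.
  have [z zE] : exists z, pr y = j z.
    apply/jN; exists (- eX (pl y)); rewrite linearN; apply/eqP.
    by rewrite -addr_eq0 addrC -eE y0.
  have hz : homog a z by apply/jh; rewrite -zE; exact: homog_prr.
  have mr : in_max (pr y) by rewrite zE; exact: jm hz.
  apply: in_max_sumP => // s; apply/eqP; apply: contraT => s0.
  (* A unit coefficient at s forces a = dS s; a nonzero component in the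
     other summand would then have a positive total degree that is at most
     tdeg (dS s) - tdeg (dR t) <= 0. *)
  have as0 : a = dS 0%N s.
    have hs := @homog_prl _ _ _ _ a y hy s.
    by apply/eqP; rewrite -subr_eq0 (const_coef_homog hs s0).
  have r0 : pr y = 0.
    apply/malgP => t; apply/malgP => u; rewrite !mcoeff0; apply/eqP; apply: contraT => u0.
    have ut : u \in msupp (pr y : {malg P[R 0%N]})@_t by rewrite -mcoeff_neq0.
    have /(_ u ut) du := @homog_prr _ _ _ _ a y hy t.
    have u1 : u != mone by apply: contraNneq u0 => ->; apply/eqP/mr.
    by have := tdeg_deg_gt0 u1; rewrite du tdegB subr_gt0 as0 ltNge wt.
  case/negP: s0; apply/eqP; apply: (mX a); first exact: homog_prl.
  by apply: ii; move: y0; rewrite eE r0 (linear0 w) (linear0 i) addr0.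
(* The map from R 1 to the kernel of e: the image of t in the free module on
   R 0 is sent by w into i X, and subtracting a lift of that element along eX
   gives an element of the kernel. *)
have /choice[h hP] : forall t, exists z : gr_ker e,
    homog (dR 1%N t) z /\ pr (val z) = j (eN << t >>).
  move=> t; pose f := j (eN << t >>).
  have hf : homog (dR 1%N t) f.
    by apply/jh/hN; exact: (@homog_basis K T _ (dR 1%N) t).
  have [x xE] : exists x, w f = i x by apply/jN; exists (eN << t >>).
  have hx : homog (dR 1%N t) x by apply/ih; rewrite -xE; exact: wh.
  have [g [hg gx]] := oX _ _ hx.
  have e0 : e (ir f - il g) = 0.
    rewrite eE (linearB pl) (linearB pr) plil plir pril prir sub0r subr0.
    by rewrite !linearN /= gx xE addNr.
  exists (Ker (introT eqP e0)); split; last by rewrite /= linearB /= prir pril subr0.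
  apply: (homogB (gr_free_graded K _)); first exact: homog_inr.
  exact: homog_inl.
pose w' : {linear gr_free K (dR 1%N) -> gr_ker e} := free_ext h.
have w'E f : pr (val (w' f)) = j (eN f).
  apply: (free_lin_eq (f := pr \o val \o w') (g := j \o eN)) => t.
  by rewrite /= free_extU; case: (hP t).
have w'h : hom_map w' by apply: homog_free_ext => // t; case: (hP t).
have [i' i'E] : exists i' : {linear gr_ker eX -> gr_ker e},
    forall x, val (i' x) = il (val x).
  apply: (ker_factor (f := il \o val)) => x.
  by rewrite [LHS]eE /= plil pril ker_valP !linear0 addr0.
have i'K x : pl (val (i' x)) = val x by rewrite i'E plil.
have i'i : injective i'.
  by move=> x y xy; apply/val_inj; rewrite -(i'K x) -(i'K y) xy.
have i'h a x : homog a x <-> homog a (i' x).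
  split=> hx; first by rewrite /= i'E; exact: homog_inl.
  have /= hp := @homog_prl _ _ _ (dR 0%N) a _ hx.
  by have := i'K x; rewrite /pl /= => <-.
have ker0 y : pr (val (y : gr_ker e)) = 0 -> exists x, y = i' x.
  move=> r0; have x0 : eX (pl (val y)) = 0.
    by apply: ii; rewrite linear0 -(ker_valP y) eE r0 (linear0 w) addr0.
  exists (Ker (introT eqP x0)); apply/val_inj; rewrite i'E /=.
  by rewrite [LHS]FE r0 (linear0 ir) addr0.
apply: (IHn (gr_ker eX) (gr_ker e) (gr_ker eN) (fun l => S l.+1) (fun l => R l.+1)
  (fun l => dS l.+1) (fun l => dR l.+1) i' w' val) => //.
- move=> a y hy; have [z zE] : exists z, pr (val y) = j z.
    apply/jN; exists (- eX (pl (val y))); rewrite linearN; apply/eqP.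
    by rewrite -addr_eq0 addrC -eE ker_valP.
  have hz : homog a z by apply/jh; rewrite -zE; exact: homog_prr.
  have [f [hf fz]] := oN _ _ hz.
  have [|x xE] := ker0 (y - w' f).
    by rewrite !linearB /= w'E fz zE subrr.
  exists x, f; split=> //; last by rewrite -xE subrK.
  have : homog a (i' x) by rewrite -xE; apply: (homogB gK hy); exact: w'h.
  by move/i'h.
- exact: val_inj.
- move=> f; split=> [[x xE]|[z ->]].
    have f0 : eN f = 0 by apply: ji; rewrite -w'E xE i'E pril linear0.
    by exists (Ker (introT eqP f0)).
  by apply: ker0; rewrite w'E ker_valP linear0.
- by move=> a z hz; apply: (mN a); [exact: hz | exact: ker_valP].
Qed.

End MinRes.

(** * Monomial ideals and the cone step *)

Section Ideals.
Variables (K : fieldType) (T : finType).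
Local Notation P := (polyring K T).
Implicit Types (U : {cmonom T} -> Prop) (u v w : {cmonom T}) (p q : P).

(** The span of the monomials in U. With U := fun u => deg u = a this is also
    the set of polynomials that are homogeneous of degree a. *)
Definition mideal U : P -> Prop := fun p => forall u, u \in msupp p -> U u.

Definition up_closed U := forall u v, U u -> U (mmul u v).

Lemma mideal0 U : mideal U 0.
Proof. by move=> u; rewrite -mcoeff_neq0 mcoeff0 eqxx. Qed.

Lemma midealD U p q : mideal U p -> mideal U q -> mideal U (p + q).
Proof. by move=> hp hq u /(fsubsetP (msuppD_le _ _)); rewrite inE => /orP[/hp|/hq]. Qed.

Lemma mideal_sum U (J : eqType) (r : seq J) (c : pred J) (f : J -> P) :
  (forall j, j \in r -> c j -> mideal U (f j)) ->
  mideal U (\sum_(j <- r | c j) f j).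
Proof.
move=> hf; rewrite big_seq_cond; apply: (big_ind (mideal U)) => [||j /andP[]].
- exact: mideal0.
- by move=> p q; exact: midealD.
- exact: hf.
Qed.

Lemma midealU U c v : U v -> mideal U << c *g v >>.
Proof. by move=> Uv u /(fsubsetP msuppU_le); rewrite inE => /eqP->. Qed.

Lemma midealM U p q : up_closed U -> mideal U q -> mideal U (p * q).
Proof.
move=> Uu hq _ /msuppM_le[u [v [_ /hq Uv ->]]].
by rewrite mulmC; exact: Uu.
Qed.

Lemma mideal_span U p : up_closed U ->
  p \in span (V := gr_poly K T) (mideal U) <-> mideal U p.
Proof.
move=> Uu; split=> [/asboolP[s sU ->]|Up]; last exact: (@mem_span _ (gr_poly K T)).
apply: mideal_sum => q /sU hq _; exact: midealM.
Qed.

Lemma mmul_inj u : injective (mmul u).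
Proof.
move=> v w /eqP/cmP uvw; apply/eqP/cmP => x.
by have /eqP := uvw x; rewrite !cmM eqn_add2l => /eqP.
Qed.

Lemma mcoeff_monoM u p w : (mono K u * p)@_(mmul u w) = p@_w.
Proof.
rewrite [p]monalgE mulr_sumr !raddf_sum; apply: eq_bigr => v _.
by rewrite /= mulrC -malgU_mul !mcoeffU (mulmC v u) (inj_eq (@mmul_inj u)).
Qed.

Lemma mideal_monoM U u p :
  mideal U (mono K u * p) <-> mideal (fun w => U (mmul u w)) p.
Proof.
split=> hp v pv; first by apply: hp; rewrite -mcoeff_neq0 mcoeff_monoM mcoeff_neq0.
case/msuppM_le: pv => w [v' [/(fsubsetP msuppU_le)]].
by rewrite inE => /eqP-> /hp Uv ->.
Qed.

Section IdealModule.
Variable a : multideg T.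
Local Notation F := (gr_free K (fun _ : unit => a)).

Definition coef1 (x : F) : P := (x : {malg P[unit]})@_tt.

Definition quot_cover U : {linear F -> gr_quot (M := gr_poly K T) (mideal U)} :=
  free_ext (fun=> quot_proj (mideal U : gr_poly K T -> Prop) (1 : gr_poly K T)).

Lemma coef1_inj : injective coef1.
Proof. by move=> x y xy; apply/malgP => -[]; exact: xy. Qed.

Lemma coef1Z p x : coef1 (p *: x) = p * coef1 x.
Proof. exact: mcoeffZ. Qed.

Lemma coef1_0 : coef1 0 = 0.
Proof. exact: mcoeff0. Qed.

Lemma coef1D x y : coef1 (x + y) = coef1 x + coef1 y.
Proof. exact: mcoeffD. Qed.

Lemma coef1U p : coef1 << p *g tt >> = p.
Proof. exact: mcoeffUU. Qed.

Lemma homog_coef1 b x : homog b x <-> homog (g := gr_poly K T) (b - a) (coef1 x).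
Proof. by split=> [hx|hx []]; [exact: (hx tt) | exact: hx]. Qed.

Lemma quot_coverE U x :
  quot_cover U x = quot_proj (mideal U : gr_poly K T -> Prop) (coef1 x : gr_poly K T).
Proof.
rewrite {1}(malg_basis_sum (x : {malg P[unit]})) linear_sum.
rewrite (bigD1 tt) //= big1 ?addr0 => [|[]] //.
rewrite linearZ /= free_extU -linearZ; congr (quot_proj _ _).
exact: mulr1.
Qed.

Lemma quot_cover0 U x : up_closed U -> quot_cover U x = 0 <-> mideal U (coef1 x).
Proof. by move=> Uu; rewrite quot_coverE quot_proj0; exact: mideal_span. Qed.

(** The monomial ideal spanned by U, placed in the free module with one basis
    element of degree a; so it is the ideal shifted by a. As a kernel it is by
    definition the first syzygy of the corresponding quotient of P. *)
Definition ideal_mod U : grmod K T := gr_ker (quot_cover U).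

Lemma ideal_modP U (x : ideal_mod U) : up_closed U -> mideal U (coef1 (val x)).
Proof. by move=> Uu; apply/quot_cover0 => //; exact: ker_valP. Qed.

Lemma ideal_mod_graded U : up_closed U -> is_graded (ideal_mod U).
Proof.
move=> Uu.
pose c u : {additive ideal_mod U -> K} :=
  (mcoeff u : {additive {malg K[{cmonom T}]} -> K}) \o
  (mcoeff tt : {additive {malg polyring K T[unit]} -> polyring K T}) \o
  (val : {linear ideal_mod U -> F}).
apply: (@graded_coef _ _ _ _ c (fun u => deg u + a)).
- move=> b x; split=> [/homog_coef1 hx u|hx].
    by rewrite [c u x]/= mcoeff_neq0 => /hx ->; rewrite subrK.
  apply/homog_coef1 => u; rewrite -mcoeff_neq0 => /hx <-.
  by rewrite addrK.
- move=> x x0; apply/val_inj/coef1_inj/malgP => u.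
  exact: etrans (x0 u) (esym (raddf0 (c u))).
- move=> b x; pose y : F := << homog_part (b - a) (coef1 (val x)) *g tt >>.
  have y0 : quot_cover U y = 0.
    apply/quot_cover0 => // u; rewrite coef1U -mcoeff_neq0 homog_partE.
    case: ifP => _; last by rewrite eqxx.
    by rewrite mcoeff_neq0; exact: (ideal_modP Uu).
  exists (Ker (introT eqP y0)) => u.
  rewrite [LHS](_ : _ = (coef1 y)@_u) // coef1U homog_partE.
  by rewrite -[deg u + a == b](inj_eq (addIr (- a))) addrK.
- move=> x; exists [seq deg u + a | u <- msupp (coef1 (val x))] => u.
  by rewrite mcoeff_neq0 => xu; apply/mapP; exists u.
- by move=> b b' p x hp hx; exact: (homogZ (gr_free_graded K _) hp hx).
Qed.

End IdealModule.

Definition cons_fam (S : nat -> finType) (l : nat) : finType :=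
  if l is l'.+1 then S l' else unit.

Definition cons_deg (a : multideg T) (S : nat -> finType)
    (dg : forall l, S l -> multideg T) (l : nat) : cons_fam S l -> multideg T :=
  match l with 0 => fun=> a | l'.+1 => @dg l' end.

Lemma divcm_mmul u v : divcm (mmul u v) u = v.
Proof. by apply/eqP/cmP => x; rewrite divcmE cmM addKn. Qed.

(** The horseshoe lemma for 0 -> U' -> U -> (P / Q)(- deg u) -> 0, where
    U = U' + (u) and Q = U' : u. *)
Lemma min_res_cone n U U' Q u a (S R : nat -> finType)
    (dS : forall l, S l -> multideg T) (dR : forall l, R l -> multideg T) :
  up_closed U -> up_closed U' -> up_closed Q ->
  (forall v, U v <-> U' v \/ exists w, v = mmul u w) ->
  (forall w, U' (mmul u w) <-> Q w) -> ~ Q mone ->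
  (forall l s t, tdeg (dS l s) <= tdeg (cons_deg (a + deg u) dR (l := l) t)) ->
  min_res n (ideal_mod a U') dS -> min_res n (ideal_mod (a + deg u) Q) dR ->
  min_res n (ideal_mod a U) (S := fun l => (S l + cons_fam R l)%type)
    (fun l => sum_deg (dS l) (cons_deg (a + deg u) dR (l := l))).
Proof.
move=> Uu Uu' Uq UE QE Q1 wt rX rN.
pose F := gr_free K (fun _ : unit => a); pose F' := gr_free K (fun _ : unit => a + deg u).
have [i iE] : exists i : {linear ideal_mod a U' -> ideal_mod a U},
    forall x, val (i x) = val x.
  apply: (ker_factor (f := val)) => x; apply/quot_cover0 => // v /(ideal_modP Uu').
  by move=> Uv; apply/UE; left.
pose m : {linear F' -> F} := GRing.scale (mono K u).
have [w wE] : exists w : {linear F' -> ideal_mod a U}, forall f, val (w f) = m f.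
  apply: (ker_factor (f := m)) => x; apply/quot_cover0 => //.
  by rewrite coef1Z; apply/mideal_monoM => v _; apply/UE; right; exists v.
have wE1 f : coef1 (val (w f)) = mono K u * coef1 f by rewrite wE; exact: coef1Z.
have H := @horseshoe K T n (ideal_mod a U') (ideal_mod a U) (ideal_mod (a + deg u) Q) S
  (cons_fam R) dS (cons_deg (a + deg u) dR) i w val (ideal_mod_graded _ Uu).
apply: H; last exact: rN; last exact: rX; last exact: wt.
- apply: (@inj_compr _ _ _ (@ker_val _ _ _ (quot_cover a U))).
  apply: (@eq_inj _ _ (@ker_val _ _ _ (quot_cover a U'))) val_inj _ => x.
  exact/esym/iE.
- by move=> b x; rewrite /= iE.
- move=> b f /homog_coef1 hf; apply/homog_coef1; rewrite wE1.
  apply/mideal_monoM => v /hf dv.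
  by rewrite degM dv addrC opprD addrA subrK.
- move=> b y /homog_coef1 hy; pose p := coef1 (val y).
  pose c v := `[< U' v >].
  pose q1 := \sum_(v <- msupp p | c v) << p@_v *g v >> : P.
  pose q2 := \sum_(v <- msupp p | ~~ c v) << p@_v *g divcm v u >> : P.
  have vE v : v \in msupp p -> ~~ c v -> mmul u (divcm v u) = v.
    move=> pv /asboolPn Uv.
    by have /UE[//|[v' ->]] := ideal_modP Uu pv; rewrite divcm_mmul.
  have pE : p = q1 + mono K u * q2.
    rewrite [LHS]monalgE (bigID c) /=; congr (_ + _); rewrite mulr_sumr.
    rewrite big_seq_cond [RHS]big_seq_cond; apply: eq_bigr => v /andP[pv cv].
    by rewrite mulrC -malgU_mul mulmC vE.
  have x0 : quot_cover a U' << q1 *g tt >> = 0.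
    apply/quot_cover0; rewrite // coef1U; apply: mideal_sum => v _ /asboolP Uv.
    exact: midealU.
  pose x : ideal_mod a U' := Ker (introT eqP x0); pose f : F' := << q2 *g tt >>.
  exists x, f; split.
  + apply/homog_coef1; rewrite coef1U.
    by apply: mideal_sum => v pv _; apply: midealU; exact: hy.
  + apply/homog_coef1; rewrite coef1U; apply: mideal_sum => v pv cv.
    apply: midealU; rewrite opprD addrA -(hy v pv) -{2}(vE v pv cv) degM.
    by rewrite addrC addKr.
  + apply/val_inj/coef1_inj.
    have -> : coef1 (val (i x + w f)) = coef1 (val (i x)) + coef1 (val (w f)).
      exact: coef1D.
    by rewrite wE1 iE /= !coef1U -pE.
- exact: val_inj.
- by [].
- move=> f; split=> [[x xE]|[z ->]].
    have f0 : quot_cover (a + deg u) Q f = 0.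
      apply/quot_cover0 => // v fv; apply/QE.
      have /mideal_monoM : mideal U' (mono K u * coef1 f).
        by rewrite -wE1 xE iE; exact: ideal_modP.
      by apply.
    by exists (Ker (introT eqP f0)).
  have x0 : quot_cover a U' (m (val z)) = 0.
    apply/quot_cover0; rewrite // coef1Z; apply/mideal_monoM => v zv.
    by apply/QE; exact: ideal_modP zv.
  pose x : ideal_mod a U' := Ker (introT eqP x0).
  by exists x; apply/val_inj; exact: (etrans (wE _) (esym (iE x))).
move=> b z hz [] /=; apply/eqP; apply: contraT.
by rewrite /const_coef mcoeff_neq0 => /(ideal_modP Uq)/Q1.
Qed.
End Ideals.

(** * Linear quotients *)

Section LinearQuotients.
Variables (K : fieldType) (d : nat) (m : 'I_d -> nat).
Local Notation T := (var m).
Implicit Types (A B s : {set T}) (gs : seq {set T}) (v w : {cmonom T}).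

(** Only the degrees of the basis elements matter, with their multiplicities;
    lists up to permutation record them without transporting bases along
    bijections. *)
Definition has_min_res n (M : grmod K T) (L : nat -> seq (multideg T)) :=
  exists (S : nat -> finType) (dg : forall l, S l -> multideg T),
    min_res n M dg /\
    forall l, perm_eq (L l) [seq dg l t | t <- enum (S l)].

Lemma has_min_res_perm n (M : grmod K T) L L' :
  (forall l, perm_eq (L' l) (L l)) -> has_min_res n M L -> has_min_res n M L'.
Proof.
move=> LL [S [dg [r LE]]]; exists S, dg; split=> // l.
exact: perm_trans (LL l) (LE l).
Qed.

Definition divides A v := [forall x in A, (0 < v x)%N].

Lemma dividesP A v : reflect (exists w, v = mmul (mono_set A) w) (divides A v).
Proof.
apply: (iffP forall_inP) => [h|[w ->] x xA].
  exists (divcm v (mono_set A)); apply/eqP/cmP => x.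
  rewrite cmM divcmE mono_setE subnKC //.
  by case: (boolP (x \in A)) => // /h.
by rewrite cmM mono_setE xA.
Qed.

(** The monomials in the ideal generated by the squarefree monomials gs. *)
Definition gen_by gs v := has (fun A => divides A v) gs.

Lemma gen_by_up gs : up_closed (gen_by gs).
Proof.
move=> u v /hasP[A Ags /forall_inP Au]; apply/hasP; exists A => //.
by apply/forall_inP => x /Au ux; rewrite cmM addn_gt0 ux.
Qed.

Lemma deg_mono_set A : deg (mono_set A) = deg_set A.
Proof.
apply/ffunP => x; rewrite /deg_set sum_ffunE ffunE mono_setE.
have [xA|xA] := boolP (x \in A).
  rewrite (bigD1 x) //= big1 => [|y /andP[_ yx]]; last by rewrite ffunE cmU (negPf yx).
  by rewrite addr0 ffunE cmUU.
rewrite big1 // => y yA; rewrite ffunE cmU.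
by case: eqP => // yx; rewrite -yx yA in xA.
Qed.

Lemma tdegD (a b : multideg T) : tdeg (a + b) = tdeg a + tdeg b.
Proof. by rewrite /tdeg -big_split; apply: eq_bigr => x _; rewrite ffunE. Qed.

Lemma tdeg_deg_set A : tdeg (deg_set A) = #|A|%:Z.
Proof.
rewrite -deg_mono_set /tdeg (eq_bigr (fun x => (x \in A)%:R)) => [|x _].
  rewrite -natr_sum natz -sum1_card [in RHS]big_mkcond; by congr Posz.
by rewrite ffunE mono_setE; case: (x \in A).
Qed.

Definition subsets n A : seq {set T} :=
  enum [set s : {set T} | (s \subset A) && (#|s| == n)].

Lemma mem_subsets n A s : (s \in subsets n A) = (s \subset A) && (#|s| == n).
Proof. by rewrite mem_enum inE. Qed.

Lemma subsets0 A : subsets 0 A = [:: set0].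
Proof.
apply: perm_small_eq => //; apply: uniq_perm; rewrite ?enum_uniq // => s.
rewrite mem_subsets inE cards_eq0 andbC; case: eqP => // ->.
exact: sub0set.
Qed.

Lemma subsets_setU1 n x A : x \notin A ->
  perm_eq (subsets n.+1 (x |: A))
    (subsets n.+1 A ++ [seq x |: s | s <- subsets n A]).
Proof.
move=> xA; have xs s : s \subset A -> x \notin s.
  by move=> sA; apply: contra xA => /(subsetP sA).
apply: uniq_perm; first exact: enum_uniq.
  rewrite cat_uniq enum_uniq map_inj_in_uniq ?enum_uniq ?andbT /=.
    apply/hasPn => _ /mapP[s _ ->]; rewrite mem_subsets.
    by apply: contra xA => /andP[/subsetP->]; rewrite // setU11.
  move=> s t; rewrite !mem_subsets => /andP[/xs xs1 _] /andP[/xs xt1 _] st.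
  by rewrite -(setU1K xs1) -(setU1K xt1) st.
move=> s; rewrite mem_cat !mem_subsets; apply/andP/orP => [[sA /eqP ns]|].
  have [xin|xin] := boolP (x \in s); [right|left].
    apply/mapP; exists (s :\ x); last by rewrite setD1K.
    rewrite mem_subsets subDset sA /=.
    by move: ns; rewrite (cardsD1 x) xin add1n => -[->].
  rewrite ns eqxx andbT; apply/subsetP => y ys.
  by have /setU1P[yx|//] := subsetP sA y ys; rewrite -yx ys in xin.
case=> [/andP[sA ns]|/mapP[t]]; first by rewrite (subset_trans sA) ?subsetUr.
rewrite mem_subsets => /andP[tA /eqP nt] ->.
by rewrite setUS // cardsU1 xs // nt.
Qed.

Lemma has_min_res_cone n gs B (Q : {cmonom T} -> Prop) a L L' :
  up_closed Q -> (forall w, gen_by gs (mmul (mono_set B) w) <-> Q w) ->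
  ~ Q mone ->
  (forall l b c, b \in L l ->
    c \in (if l is l'.+1 then L' l' else [:: a + deg (mono_set B)]) ->
    tdeg b <= tdeg c) ->
  has_min_res n (ideal_mod K a (gen_by gs)) L ->
  has_min_res n (ideal_mod K (a + deg (mono_set B)) Q) L' ->
  has_min_res n (ideal_mod K a (gen_by (rcons gs B)))
    (fun l => L l ++ if l is l'.+1 then L' l' else [:: a + deg (mono_set B)]).
Proof.
move=> Qu QE Q1 wt [S [dS [rS LS]]] [R [dR [rR LR]]].
pose b := a + deg (mono_set B); pose L1 l := if l is l'.+1 then L' l' else [:: b].
have LR' l : perm_eq (L1 l) [seq cons_deg b dR t | t <- enum (cons_fam R l)].
  case: l => [|l]; last exact: LR.
  by rewrite /= enumT unlock.
exists (fun l => (S l + cons_fam R l)%type),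
  (fun l => sum_deg (dS l) (cons_deg b dR (l := l))); split.
  apply: (min_res_cone (U' := gen_by gs) (Q := Q)) => //; try exact: gen_by_up.
    move=> v; rewrite /gen_by has_rcons orbC; split.
      by case/orP; [left | move/dividesP; right].
    by case=> [->//|/dividesP ->]; rewrite orbT.
  move=> l s t; apply: (wt l).
    by rewrite (perm_mem (LS l)); apply: map_f; rewrite mem_enum.
  by rewrite -/(L1 l) (perm_mem (LR' l)); apply: map_f; rewrite mem_enum.
move=> l; rewrite enumT unlock /= /sum_enum map_cat -!map_comp.
by apply: perm_cat; rewrite -?enumT; [exact: LS | exact: LR'].
Qed.


Definition var_gens A : seq {set T} := [seq [set x] | x <- enum A].

Definition shifts a (r : seq {set T}) : seq (multideg T) :=
  [seq a + deg_set s | s <- r].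

Lemma gen_by_vars A w : gen_by (var_gens A) w <-> exists x, x \in A /\ (0 < w x)%N.
Proof.
split=> [/hasP[_ /mapP[x xA ->] /forall_inP h]|[x [xA wx]]].
  by exists x; rewrite -mem_enum; split=> //; apply: h; rewrite inE.
apply/hasP; exists [set x]; first by apply: map_f; rewrite mem_enum.
by apply/forall_inP => y /set1P->.
Qed.

Lemma ideal_mod_eq n U U' a L : (forall v, U v <-> U' v) ->
  has_min_res n (ideal_mod K a U) L -> has_min_res n (ideal_mod K a U') L.
Proof. by move=> UU'; rewrite (_ : U = U') //; apply/funext => v; apply/propext. Qed.

Lemma has_min_res0 n a : has_min_res n (ideal_mod K a (gen_by [::])) (fun=> [::]).
Proof.
exists (fun=> void), (fun l (t : void) => match t with end); split.
  apply: min_res_zero => //.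
    by apply: ideal_mod_graded; exact: gen_by_up.
  move=> x; apply/val_inj/coef1_inj; rewrite [RHS]coef1_0; apply/malgP => u.
  rewrite mcoeff0; apply/eqP; rewrite mcoeff_eq0.
  by apply/negP => /(ideal_modP (@gen_by_up [::])).
by move=> l; rewrite enumT unlock.
Qed.

Lemma mem_shift_tdeg a n A b : b \in shifts a (subsets n A) -> tdeg b = tdeg a + n%:Z.
Proof.
case/mapP => s; rewrite mem_subsets => /andP[_ /eqP ns] ->.
by rewrite tdegD tdeg_deg_set ns.
Qed.

(** Remove one variable x from A: the colon ideal by x of the ideal generated
    by the other variables is that ideal itself. *)
Lemma koszul n a A : has_min_res n (ideal_mod K a (gen_by (var_gens A)))
  (fun l => shifts a (subsets l.+1 A)).
Proof.
elim: {A}#|A| {-2}A (erefl #|A|) a => [|c IHc] A Ac a.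
  have -> : A = set0 by apply/eqP; rewrite -cards_eq0 Ac.
  apply: has_min_res_perm (_ : has_min_res n _ (fun=> [::])) => [l|].
    rewrite (_ : subsets _ _ = [::]) //; apply: size0nil; apply/eqP.
    rewrite -all_pred0; apply/allP => s; rewrite mem_subsets subset0 => /andP[/eqP->].
    by rewrite cards0.
  by rewrite /var_gens enum_set0; exact: has_min_res0.
have [x xA] : exists x, x \in A by apply/card_gt0P; rewrite Ac.
have Bc : #|A :\ x| = c by move: Ac; rewrite (cardsD1 x) xA add1n => -[].
have xB : x \notin A :\ x by rewrite setD11.
have dx : deg (mono_set [set x]) = deg (ucm x) by rewrite deg_mono_set /deg_set big_set1.
have /= r := has_min_res_cone (B := [set x]) (gs := var_gens (A :\ x)) (a := a)
  (Q := gen_by (var_gens (A :\ x))) (@gen_by_up _) _ _ _ (IHc _ Bc a) (IHc _ Bc _).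
apply: (ideal_mod_eq (U := gen_by (rcons (var_gens (A :\ x)) [set x]))).
  move=> v; rewrite /gen_by has_rcons -/(gen_by _ _).
  split=> [/orP[/forall_inP h|/gen_by_vars[y [yA vy]]]|/gen_by_vars[y [yA vy]]].
  - by apply/gen_by_vars; exists x; split=> //; apply: h; rewrite inE.
  - by apply/gen_by_vars; exists y; split=> //; move: yA; rewrite inE => /andP[].
  have [yx|yx] := eqVneq y x.
    by apply/orP; left; apply/forall_inP => z /set1P->; rewrite -yx.
  by apply/orP; right; apply/gen_by_vars; exists y; rewrite !inE yx.
apply: has_min_res_perm (r _ _ _) => [l|w||l b e].
- rewrite -{1}(setD1K xA); apply: perm_trans (perm_map _ (subsets_setU1 l xB)) _.
  rewrite map_cat perm_cat2l.
  case: l => [|l]; first by rewrite subsets0 /= setU0 deg_mono_set.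
  rewrite -map_comp dx; apply/permP => P; congr (count P _).
  apply/eq_in_map => s; rewrite mem_subsets => /andP[sB _] /=.
  rewrite /deg_set big_setU1 ?addrA //.
  by apply: contra xB => /(subsetP sB).
- split=> /gen_by_vars[y [yA wy]]; apply/gen_by_vars; exists y; split=> //.
    move: wy; rewrite cmM mono_setE inE; case: eqP => // yx.
    by rewrite yx (negPf xB) in yA.
  by rewrite cmM addn_gt0 wy orbT.
- by case/gen_by_vars => y [_]; rewrite cm1.
move/mem_shift_tdeg ->; case: l => [|l].
  by rewrite inE => /eqP->; rewrite tdegD deg_mono_set tdeg_deg_set cards1.
move/mem_shift_tdeg ->; rewrite tdegD deg_mono_set tdeg_deg_set cards1 -addrA.
by rewrite -PoszD add1n.
Qed.

(** Linear quotients with respect to a nondecreasing order of the degrees: the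
    set c B generates the colon ideal by B of the ideal of its predecessors. *)
Definition lin_quot (c : {set T} -> {set T}) gs := forall hs B rest,
  gs = hs ++ B :: rest ->
  (forall w, gen_by hs (mmul (mono_set B) w) <-> exists x, x \in c B /\ (0 < w x)%N)
  /\ (forall A, A \in hs -> #|A| <= #|B|)%N.

Definition betti_degrees (c : {set T} -> {set T}) a gs l : seq (multideg T) :=
  flatten [seq shifts (a + deg (mono_set B)) (subsets l (c B)) | B <- gs].

(** The generators are added one by one: at B, the cone step contributes the
    Koszul resolution of the colon ideal, whose basis consists of the subsets
    of c B. *)
Lemma lin_quot_min_res n c a gs : lin_quot c gs ->
  has_min_res n (ideal_mod K a (gen_by gs)) (betti_degrees c a gs).
Proof.
elim/last_ind: gs => [_|gs B IHgs lq]; first exact: has_min_res0.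
have [|qB sB] := lq gs B [::]; first by rewrite cats1.
have {}IHgs : has_min_res n (ideal_mod K a (gen_by gs)) (betti_degrees c a gs).
  by apply: IHgs => hs A rest E; apply: (lq hs A (rcons rest B)); rewrite E rcons_cat.
have /= r := has_min_res_cone (B := B) (a := a)
  (Q := gen_by (var_gens (c B))) (@gen_by_up _) _ _ _ IHgs (koszul n _ _).
apply: has_min_res_perm (r _ _ _) => [l|w||l b e].
- rewrite /betti_degrees map_rcons flatten_rcons perm_cat2l.
  by case: l => [|l] //; rewrite subsets0 /shifts /= /deg_set big_set0 addr0.
- exact: (iff_trans (qB w) (iff_sym (gen_by_vars _ _))).
- by case/gen_by_vars => y [_]; rewrite cm1.
case/flatten_mapP => A /sB AB /mem_shift_tdeg ->.
rewrite tdegD [in tdeg (deg _)]deg_mono_set tdeg_deg_set.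
have le : tdeg a + #|A|%:Z + l%:Z <= tdeg a + #|B|%:Z + l%:Z.
  by rewrite lerD2r lerD2l lez_nat.
case: l le => [|l] le.
  by rewrite inE => /eqP->; rewrite tdegD deg_mono_set tdeg_deg_set -[X in _ <= X]addr0.
by move/mem_shift_tdeg ->; rewrite tdegD deg_mono_set tdeg_deg_set.
Qed.

End LinearQuotients.

(** * Color-squarefree sets of variables *)

Section Colored.
Variables (d : nat) (m : 'I_d -> nat).
Local Notation T := (var m).
Implicit Types (A B : {set T}) (x y z : T).

Lemma var_gt_irr x : var_gt x x = false.
Proof. by rewrite /var_gt !ltnn andbF. Qed.

Lemma var_gt_trans y x z : var_gt x y -> var_gt y z -> var_gt x z.
Proof.
case/orP=> [xy|/andP[/eqP xy txy]] /orP[yz|/andP[/eqP yz tyz]]; apply/orP.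
- by left; exact: ltn_trans xy yz.
- by left; rewrite -yz.
- by left; rewrite xy.
- by right; rewrite xy yz eqxx (ltn_trans txy tyz).
Qed.

Lemma same_color_eq x y :
  color x = color y -> (tagged x : nat) = tagged y -> x = y.
Proof.
case: x y => [i a] [j b]; rewrite /color /= => ij; case: j / ij b => b ab.
by congr existT; exact/val_inj.
Qed.

Lemma var_gt_total x y : x != y -> var_gt x y || var_gt y x.
Proof.
move=> xy; rewrite /var_gt.
case: (ssrnat.ltngtP (color x) (color y)) => cxy; rewrite ?orbT //=.
have {}cxy : color x = color y by exact: val_inj.
rewrite cxy eqxx /=; case: ssrnat.ltngtP => // txy.
by rewrite (same_color_eq cxy txy) eqxx in xy.
Qed.

(** Larger variables have smaller rank. *)
Definition rank x : nat := #|[set y | var_gt y x]|.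

Lemma rank_lt x y : var_gt y x -> (rank y < rank x)%N.
Proof.
move=> yx; apply/proper_card/properP; split.
  by apply/subsetP => z; rewrite !inE => zy; exact: var_gt_trans zy yx.
by exists y; rewrite !inE // var_gt_irr.
Qed.

Lemma smallest_varP A : A != set0 ->
  exists x, x \in A /\ forall y, y \in A -> y != x -> var_gt y x.
Proof.
case/set0Pn => x0 x0A; case: (arg_maxnP rank x0A) => x xA xmax.
exists x; split=> // y yA /var_gt_total/orP[//|/rank_lt].
by have /= := xmax y yA; rewrite leqNgt => /negPf->.
Qed.

Definition color_sf A := forall x y, x \in A -> y \in A -> color x = color y -> x = y.

Lemma color_sfP A : color_squarefree (mono_set A) <-> color_sf A.
Proof.
rewrite /color_squarefree /color_sf; split=> [[_ h] x y xA yA|h].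
  by apply: h; rewrite mono_setE lt0b.
by split=> [x|x y]; rewrite !mono_setE ?leq_b1 // !lt0b; exact: h.
Qed.

Definition swap x y A := y |: (A :\ x).

Lemma mono_swap x y A : x \in A -> y \notin A ->
  mmul (ucm y) (divcm (mono_set A) (ucm x)) = mono_set (swap x y A).
Proof.
move=> xA yA; apply/eqP/cmP => z.
rewrite cmM divcmE !mono_setE !cmU !inE (eq_sym z y) (eq_sym z x).
have [<-|_] := eqVneq y z; first by rewrite (negPf yA).
by have [<-|_] := eqVneq x z; rewrite ?xA ?subn0.
Qed.

Lemma color_sf_swap x y A : color_sf A ->
  (forall z, z \in A -> z != x -> color z != color y) -> color_sf (swap x y A).
Proof.
move=> cA h z t /setU1P[->|/setD1P[zx zA]] /setU1P[->|/setD1P[tx tA]] //.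
- by move=> e; have := h t tA tx; rewrite e eqxx.
- by move=> e; have := h z zA zx; rewrite e eqxx.
- exact: cA.
Qed.

Definition weight A : nat := (\sum_(x in A) rank x)%N.

Lemma card_swap x y A : x \in A -> y \notin A -> #|swap x y A| = #|A|.
Proof.
move=> xA yA; rewrite cardsU1 (cardsD1 x A) xA !inE (negPf yA) andbF.
by [].
Qed.

Lemma weight_swap x y A : x \in A -> y \notin A -> var_gt y x ->
  (weight (swap x y A) < weight A)%N.
Proof.
move=> xA yA yx; rewrite /weight /swap big_setU1 ?inE ?(negPf yA) ?andbF //=.
by rewrite [X in (_ < X)%N](big_setD1 x) //= ltn_add2r rank_lt.
Qed.

(** Lexicographic comparison of (#|A|, weight A), encoded in one number. *)
Definition key A : nat := (#|A| * (weight setT).+1 + weight A)%N.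

Lemma weight_max A : (weight A <= weight setT)%N.
Proof.
rewrite /weight [X in (_ <= X)%N](bigID (mem A)) /=.
rewrite [X in (_ <= X + _)%N](eq_bigl (mem A)) ?leq_addr // => x.
by rewrite inE.
Qed.

Lemma key_le A B : (key A <= key B)%N ->
  (#|A| <= #|B|)%N /\ (#|A| = #|B| -> (weight A <= weight B)%N).
Proof.
rewrite /key; have := weight_max A; have := weight_max B.
move: (weight A) (weight B) (weight setT) #|A| #|B| => a b c s t; split; nia.
Qed.

Lemma key_lt A B : (#|A| < #|B|)%N \/ #|A| = #|B| /\ (weight A < weight B)%N ->
  (key A < key B)%N.
Proof.
rewrite /key; have := weight_max A; have := weight_max B.
move: (weight A) (weight B) (weight setT) #|A| #|B| => a b c s t; nia.
Qed.

(** Once x has a color absent from B, the condition on its color is strict. *)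
Lemma in_sm B x : reflect
  ((forall y, y \in B -> color y != color x) /\
     (exists y, y \in B /\ (color x < color y)%N) \/
   exists y, [/\ y \in B, color y = color x & (tagged x < tagged y)%N])
  (x \in sm (mono_set B)).
Proof.
have cP i : reflect (exists y, y \in B /\ color y = i) (i \in cSupp (mono_set B)).
  rewrite inE; apply: (iffP existsP) => [[y /andP[]]|[y [yB <-]]].
    by rewrite mono_setE lt0b => yB /eqP; exists y.
  by exists y; rewrite mono_setE yB eqxx.
rewrite /sm; move: (cSupp _) cP => C cP.
rewrite !inE; apply: (iffP orP) =>
  [[/andP[nx /exists_inP[i /cP[y [yB <-]] xi]]|/existsP[y]]|].
- left; split=> [z zB|].
    by apply: contraNneq nx => e; apply/cP; exists z.
  exists y; split=> //; rewrite ltn_neqAle xi andbT.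
  by apply: contraNneq nx => /val_inj e; apply/cP; exists y.
- by rewrite mono_setE lt0b => /and3P[yB /eqP e l]; right; exists y.
case=> [[nx [y [yB xy]]]|[y [yB e l]]]; [left|right].
  apply/andP; split.
    by apply/negP => /cP[z [/nx zx zE]]; rewrite zE eqxx in zx.
  by apply/exists_inP; exists (color y); [apply/cP; exists y | exact: ltnW].
by apply/existsP; exists y; rewrite mono_setE yB e eqxx l.
Qed.

Lemma sm_disjoint B x : color_sf B -> x \in B -> x \notin sm (mono_set B).
Proof.
move=> cB xB; apply/negP => /in_sm[[/(_ x xB)]|[y [yB e]]]; first by rewrite eqxx.
by rewrite (cB _ _ yB xB e) ltnn.
Qed.

End Colored.

(** * Generators of an ideal stable across colors *)

Section MonomialIdeals.
Variables (K : fieldType) (T : finType) (I : polyring K T -> Prop).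
Hypothesis monoI : monomial_ideal I.

Lemma monomial_ideal_up : up_closed (fun u => I (mono K u)).
Proof.
move=> u v; case: monoI => S IE /IE Iu; apply/IE.
have -> : mono K (mmul u v) = (mono K v : polyring K T) *: (mono K u : gr_poly K T).
  by rewrite /mono mulmC; exact: malgU_mul.
exact: rpredZ.
Qed.

Lemma monomial_idealE : I = mideal (fun u => I (mono K u)).
Proof.
apply/funext => f; apply/propext; split.
  case: (monoI) => S IE /IE/asboolP[s sS ->].
  apply: mideal_sum => p /sS[u Su pE] _; apply: midealM; first exact: monomial_ideal_up.
  rewrite pE; apply: midealU; apply/IE; apply: mem_span; by exists u.
have [S IE] := monoI => If; apply/IE.
rewrite [f]monalgE big_seq; apply: rpred_sum => u fu.
have -> : << f@_u *g u >> =
    (<< f@_u *g mone >> : polyring K T) *: (mono K u : gr_poly K T).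
  by apply: etrans (malgU_mul _ _ _); rewrite mul1m.
by apply: rpredZ; apply/IE; exact: If.
Qed.

(** Descent on the total degree. *)
Lemma min_gen_divides v : I (mono K v) -> exists u w, min_gen I u /\ v = mmul u w.
Proof.
elim: {v}(mdeg v).+1 {-2}v (ltnSn (mdeg v)) => // n IHn v vn Iv.
have [mv|] := pselect (min_gen I v); first by exists v, mone; rewrite mulm1.
rewrite /min_gen => /not_andP[//|/existsNP[u /existsNP[w]]].
move=> /not_implyP[Iu /not_implyP[vE uv]].
have [|u' [w' [mu uE]]] := IHn u _ Iu.
  have w1 : mdeg w != 0%N.
    by rewrite mdeg_eq0; apply: contra_notN uv => /eqP w1; rewrite vE w1 mulm1.
  by move: vn; rewrite vE mdegM ltnS; apply: leq_trans; rewrite -addn1 leq_add2l lt0n.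
by exists u', (mmul w' w); rewrite mulmA -uE.
Qed.

End MonomialIdeals.

Section Stable.
Variables (K : fieldType) (d : nat) (m : 'I_d -> nat).
Local Notation T := (var m).
Variable I : polyring K T -> Prop.
Hypothesis stabI : stable_across_colors I.
Implicit Types (A B : {set T}) (x y z : T).

Let IA A := I (mono K (mono_set A)).

Let monoI : monomial_ideal I. Proof. by case: stabI => -[]. Qed.

Lemma mono_set_div A B : A \subset B -> exists w, mono_set B = mmul (mono_set A) w.
Proof.
move=> AB; apply/dividesP/forall_inP => x xA.
by rewrite mono_setE (subsetP AB x xA).
Qed.

Definition gens : {set {set T}} := [set B | `[< min_gen I (mono_set B) >]].

Lemma gensP B : reflect (min_gen I (mono_set B)) (B \in gens).
Proof. by rewrite inE; exact: asboolP. Qed.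

Lemma gens_color_sf B : B \in gens -> color_sf B.
Proof. by move/gensP => mB; apply/color_sfP; case: stabI => -[_ h] _ _; exact: h. Qed.

Lemma gens_min A B : B \in gens -> IA A -> A \subset B -> A = B.
Proof.
move=> /gensP[_ h] IAA /mono_set_div[w E].
by apply: (@mono_set_inj d m); exact: h IAA E.
Qed.

Lemma gens_below v : I (mono K v) -> exists2 A, A \in gens & divides A v.
Proof.
move=> /min_gen_divides[u [w [mu ->]]].
have cu : color_squarefree u by case: stabI => -[_ h] _ _; exact: h.
rewrite -(mono_set_supp cu) in mu *; set A := [set x | _] in mu *.
by exists A; [exact/gensP | apply/dividesP; exists w].
Qed.

Lemma swap_color x y A : color_sf A -> IA A -> x \in A -> color y = color x ->
  (tagged y < tagged x)%N -> y \notin A -> IA (swap x y A).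
Proof.
move=> cA IAA xA cyx tyx yA; have [_ h _] := stabI.
rewrite /IA -(mono_swap xA yA).
have E : mmul (ucm x) (divcm (mono_set A) (ucm x)) = mono_set A.
  apply/eqP/cmP => z; rewrite cmM divcmE cmU subnKC // mono_setE.
  by case: eqP => // <-; rewrite xA.
case: x y cyx tyx E xA yA => [k l] [k' j]; rewrite /color /= => ek.
case: k / ek l => l lj E xA yA.
have := h k' j l (divcm (mono_set A) (ucm (Tagged (fun i => 'I_(m i)) l))).
by cbv zeta; rewrite [mmul (ucm _) _]E => H; apply: H => //; exact/color_sfP.
Qed.

Lemma swap_smallest x y A : color_sf A -> IA A -> x \in A ->
  (forall z, z \in A -> z != x -> var_gt z x) -> var_gt y x -> y \notin A ->
  color_sf (swap x y A) -> IA (swap x y A).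
Proof.
move=> cA IAA xA xmin yx yA cs; have [_ _ h] := stabI.
rewrite /IA -(mono_swap xA yA); apply: (h _ x y) => //; first 1 last.
- by split=> [|z]; rewrite mono_setE lt0b // => zA /eqP zx; exact: xmin.
- by rewrite (mono_swap xA yA); exact/color_sfP.
exact/color_sfP.
Qed.

(** As long as A is not contained in B, a variable x of A outside B can be
    exchanged for a larger variable y of B outside A, staying in I and avoiding
    [sm B]: if x shares its color with some y in B, use the first stability
    condition; otherwise every such x has a color beyond those of B, and the
    second condition applies to the smallest variable of A. Each exchange
    lowers the weight and keeps the cardinal; at the end A is contained in B,
    hence equal to B. *)
Lemma gens_first A B : B \in gens -> color_sf A -> IA A -> (#|A| <= #|B|)%N ->
  (forall x, x \in A -> x \notin sm (mono_set B)) ->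
  #|A| = #|B| /\ (A = B \/ (weight B < weight A)%N).
Proof.
move=> gB; have cB := gens_color_sf gB.
elim: {A}(weight A).+1 {-2}A (ltnSn (weight A)) => // n IHn A An cA IAA AB Asm.
have [sAB|nAB] := boolP (A \subset B).
  by rewrite (gens_min gB IAA sAB); split; auto.
have step x y : x \in A -> y \in B -> y \notin A -> var_gt y x ->
    color_sf (swap x y A) -> IA (swap x y A) ->
    #|A| = #|B| /\ (A = B \/ (weight B < weight A)%N).
  move=> xA yB yA yx cS IS; have wlt := weight_swap xA yA yx.
  have := IHn _ (leq_trans wlt An) cS IS; rewrite card_swap // => /(_ AB)[z|-> w].
    by case/setU1P => [->|/setD1P[_ /Asm]] //; exact: sm_disjoint.
  by split=> //; right; case: w => [<-|w] //; exact: ltn_trans w wlt.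
have [/existsP[x /and3P[xA xB /existsP[y /andP[yB /eqP yx]]]]|nsame] :=
  boolP [exists x, [&& x \in A, x \notin B
    & [exists y, (y \in B) && (color y == color x)]]].
  have yA : y \notin A by apply: contra xB => yA; rewrite (cA x y).
  have tyx : (tagged y < tagged x)%N.
    rewrite ltnNge leq_eqVlt; apply/negP => /orP[/eqP t|t].
      by case/negP: xB; rewrite (same_color_eq (esym yx) t).
    by case/negP: (Asm x xA); apply/in_sm; right; exists y.
  apply: (step x y xA yB yA); last exact: (swap_color cA IAA xA yx tyx yA).
    by rewrite /var_gt yx eqxx tyx orbT.
  apply: (color_sf_swap cA) => z zA; apply: contraNneq => zy.
  by rewrite (cA z x) // zy.
have far x : x \in A -> x \notin B -> forall y, y \in B -> (color y < color x)%N.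
  move=> xA xB; have nc y : y \in B -> color y != color x.
    move=> yB; apply: contraNneq nsame => yx; apply/existsP; exists x.
    by rewrite xA xB; apply/existsP; exists y; rewrite yB yx eqxx.
  move=> y yB; rewrite ltnNge; apply/negP; rewrite leq_eqVlt => /orP[/eqP/val_inj e|l].
    by have := nc y yB; rewrite e eqxx.
  by case/negP: (Asm x xA); apply/in_sm; left; split=> //; exists y.
have [z zA zB] : exists2 z, z \in A & z \notin B by apply/subsetPn.
have [|x [xA xmin]] := @smallest_varP _ _ A; first by apply/set0Pn; exists z.
have xB : x \notin B.
  apply/negP => xB; have zx : z != x by apply: contraNneq zB => ->.
  have /orP[] := xmin z zA zx; rewrite ?ltnNge ?(ltnW (far z zA zB x xB)) //.
  by case/andP => /eqP zxE _; have := far z zA zB x xB; rewrite zxE ltnn.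
have [y yB yA] : exists2 y, y \in B & y \notin A.
  apply/subsetPn; apply: contra nAB => BA.
  by have /eqP -> : B == A by rewrite eqEcard BA.
have yx := far x xA xB y yB.
have gyx : var_gt y x by rewrite /var_gt yx.
have cS : color_sf (swap x y A).
  apply: color_sf_swap => // t tA _; apply/eqP => ty.
  have [tB|tB] := boolP (t \in B).
    by case/negP: yA; rewrite -(cB t y).
  by have := far t tA tB y yB; rewrite ty ltnn.
exact: (step x y xA yB yA gyx cS (swap_smallest cA IAA xA xmin gyx yA cS)).
Qed.

(** One exchange turns B into a set of I inside x |: B with smaller weight; any
    generator below it comes before B. *)
Lemma gens_swap B x : B \in gens -> x \in sm (mono_set B) ->
  exists A, [/\ A \in gens, A \subset x |: B & (key A < key B)%N].
Proof.
move=> gB xs; have cB := gens_color_sf gB; have [IB _] := gensP _ gB.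
have xB : x \notin B by apply: contraL xs; exact: sm_disjoint.
suff [y [yB xy ISw]] : exists y, [/\ y \in B, var_gt x y & IA (swap y x B)].
  have [A gA /forall_inP AS] := gens_below ISw.
  have {}AS : A \subset swap y x B.
    by apply/subsetP => z /AS; rewrite mono_setE lt0b.
  exists A; split=> //; first by apply: subset_trans AS _; rewrite setUS ?subD1set.
  apply: key_lt; have [|lt] := ssrnat.leqP #|swap y x B| #|A|; last first.
    by left; rewrite -(card_swap yB xB).
  move=> le; right; have /eqP -> : A == swap y x B by rewrite eqEcard AS.
  by rewrite card_swap // weight_swap.
case/in_sm: xs => [[nx [z [zB xz]]]|[y [yB yx t]]].
  have [|y [yB ymin]] := @smallest_varP _ _ B; first by apply/set0Pn; exists z.
  have xy : (color x < color y)%N.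
    have [<-//|zy] := eqVneq z y; apply: leq_trans xz _.
    by case/orP: (ymin z zB zy) => [/ltnW//|/andP[/eqP -> _]].
  have gxy : var_gt x y by rewrite /var_gt xy.
  have cS : color_sf (swap y x B) by apply: (color_sf_swap cB) => t tB _; exact: nx.
  by exists y; split; last exact: (swap_smallest cB IB yB ymin gxy xB cS).
exists y; split; [exact: yB | by rewrite /var_gt yx eqxx t orbT |].
exact: (swap_color cB IB yB (esym yx) t xB).
Qed.

Definition gen_seq : seq {set T} := sort (fun A B => key A <= key B)%N (enum gens).

Lemma mem_gen_seq B : (B \in gen_seq) = (B \in gens).
Proof. by rewrite mem_sort mem_enum. Qed.

Lemma gen_seq_uniq : uniq gen_seq.
Proof. by rewrite sort_uniq enum_uniq. Qed.

Lemma gen_by_gen_seq : (fun u => I (mono K u)) = gen_by gen_seq.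
Proof.
apply/funext => v; apply/propext; split.
  by case/gens_below => A gA Av; apply/hasP; exists A; rewrite ?mem_gen_seq.
case/hasP => A; rewrite mem_gen_seq => /gensP[IAA _] /dividesP[w ->].
exact: (@monomial_ideal_up K T I monoI _ _ IAA).
Qed.

Lemma lin_quot_gen_seq : lin_quot (fun B => sm (mono_set B)) gen_seq.
Proof.
move=> hs B rest E.
have gB : B \in gens by rewrite -mem_gen_seq E mem_cat inE eqxx orbT.
have : sorted (fun A B => key A <= key B)%N gen_seq.
  by apply: sort_sorted => A C; exact: leq_total.
have tr : transitive (fun A B : {set T} => key A <= key B)%N.
  by move=> C A D; exact: leq_trans.
rewrite (sorted_pairwise tr) E pairwise_cat => /and3P[/allrelP hsB _ /andP[/allP Br _]].
have {}hsB A : A \in hs -> (key A <= key B)%N.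
  by move=> Ahs; apply: hsB; rewrite ?inE ?eqxx.
have below A : A \in gens -> (key A < key B)%N -> A \in hs.
  rewrite -mem_gen_seq E mem_cat inE => /or3P[//|/eqP->|/Br /=]; first by rewrite ltnn.
  by rewrite leqNgt => /negPf->.
have Bhs : B \notin hs.
  have := gen_seq_uniq; rewrite E cat_uniq => /and3P[_ /hasPn/(_ B) + _].
  by apply; rewrite inE eqxx.
have hs_gens A : A \in hs -> A \in gens by move=> Ahs; rewrite -mem_gen_seq E mem_cat Ahs.
split=> [w|A /hsB/key_le[]//].
split=> [/hasP[A Ahs /forall_inP Aw]|[x [xs wx]]].
  have [AB wAB] := key_le (hsB A Ahs).
  have [/existsP[x /andP[xs wx]]|/existsPn nx] :=
      boolP [exists x, (x \in sm (mono_set B)) && (0 < w x)%N]; first by exists x.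
  have [IAA _] := gensP _ (hs_gens A Ahs).
  have [|AB' [AB''|lt]] := gens_first gB (gens_color_sf (hs_gens A Ahs)) IAA AB.
  - move=> x xA; apply/negP => xs; have := nx x; rewrite xs /=.
    have := Aw x xA; rewrite cmM mono_setE.
    rewrite (_ : x \in B = false) ?add0n => [->|] //.
    by apply/negP => /(sm_disjoint (gens_color_sf gB)); rewrite xs.
  - by rewrite -AB'' Ahs in Bhs.
  - by have := wAB AB'; rewrite leqNgt lt.
have [A [gA /subsetP AS lt]] := gens_swap gB xs.
apply/hasP; exists A; first exact: below.
apply/forall_inP => z /AS/setU1P[->|zB]; rewrite cmM addn_gt0 ?wx ?orbT //.
by rewrite mono_setE zB.
Qed.

End Stable.

(** * Graded Betti numbers *)

Lemma perm_eq_bij (X : eqType) (I J : finType) (f : I -> X) (g : J -> X) :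
  perm_eq [seq f i | i <- enum I] [seq g j | j <- enum J] ->
  exists h : I -> J, bijective h /\ forall i, g (h i) = f i.
Proof.
move=> fg; have IJ : #|I| = #|J|.
  by rewrite !cardE; have := perm_size fg; rewrite !size_map.
have [i0 _|I0] := pickP (predT : pred I); last first.
  exists (fun i => False_rect J (notF (esym (I0 i)))); split=> [|i]; last by have := I0 i.
  by apply: inj_card_bij; rewrite ?IJ // => i; have := I0 i.
have j0 : J by apply: (@enum_val J (mem J)); rewrite -IJ; exact: enum_rank i0.
have /(perm_iotaP (g j0))[r rP rE] := fg.
rewrite size_map in rP.
pose h (i : I) := nth j0 (enum J) (nth 0%N r (enum_rank i)).
have sr : size r = #|I| by rewrite (perm_size rP) size_iota IJ cardE.
have lr (i : I) : (nth 0%N r (enum_rank i) < #|J|)%N.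
  have : nth 0%N r (enum_rank i) \in r by apply: mem_nth; rewrite sr.
  by rewrite (perm_mem rP) mem_iota add0n -cardE.
exists h; split.
  apply: inj_card_bij; rewrite ?IJ // => i i' /eqP.
  rewrite nth_uniq ?enum_uniq -?cardE // nth_uniq ?sr ?(perm_uniq rP) ?iota_uniq //.
  by move=> /eqP/val_inj/enum_rank_inj.
move=> i; have := congr1 (fun s => nth (g j0) s (enum_rank i)) rE.
rewrite (nth_map i) -?cardE // nth_enum_rank (nth_map 0%N) ?sr // => ->.
by rewrite (nth_map j0) // -cardE.
Qed.

Section Final.
Variables (K : fieldType) (T : finType).
Implicit Types U : {cmonom T} -> Prop.

(** Minimality holds because the ideal is proper. *)
Lemma min_cover_quot U : up_closed U -> ~ U mone -> min_cover (@quot_cover K T 0 U).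
Proof.
move=> Uu U1; split=> [a x /homog_coef1 hx|a q [p hp <-]|a y _].
- by exists (coef1 x); rewrite ?quot_coverE // -[a]subr0.
- exists << (p : polyring K T) *g tt >>; split; last by rewrite quot_coverE coef1U.
  by apply/homog_coef1; rewrite coef1U subr0.
move/(quot_cover0 _ Uu) => yU [] /=; apply/eqP; apply: contraT.
by rewrite /const_coef mcoeff_neq0 => /yU.
Qed.

End Final.

Lemma tor_monomial_quot (K : fieldType) (d : nat) (m : 'I_d -> nat) n
    (U : {cmonom var m} -> Prop) (L : nat -> seq (multideg (var m))) :
  up_closed U -> ~ U mone -> is_graded (gr_quot (M := gr_poly K (var m)) (mideal U)) ->
  has_min_res n.+1 (ideal_mod K 0 U) L ->
  exists (J : finType) (dg : J -> multideg (var m)),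
    perm_eq (L n) [seq dg j | j <- enum J] /\
    graded_iso (Tor n.+1 (gr_quot (M := gr_poly K (var m)) (mideal U))
      (residue_field K (var m))) (gr_sum_shift dg (residue_field K (var m))).
Proof.
move=> Uu U1 gM [S [dg [rS LS]]]; exists (S n), (dg n); split; first exact: LS.
apply: (@tor_min_res K (var m) n _ (cons_fam S) (cons_deg 0 dg) gM).
by exists (@quot_cover K _ 0 U); split; [exact: min_cover_quot | exact: rS].
Qed.

Lemma betti_index_degrees (K : fieldType) (d : nat) (m : 'I_d -> nat)
    (I : polyring K (var m) -> Prop) n :
  perm_eq [seq deg (mono_set (val p).1) + deg_set (val p).2 |
            p <- enum (betti_index I n.+1)]
    (betti_degrees (fun B => sm (mono_set B)) 0 (gen_seq I) n).
Proof.
pose prs := [seq (B, s) | B <- gen_seq I, s <- subsets n (sm (mono_set B))].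
have -> : betti_degrees (fun B => sm (mono_set B)) 0 (gen_seq I) n =
    [seq deg (mono_set p.1) + deg_set p.2 | p <- prs].
  rewrite map_flatten -map_comp /betti_degrees; congr flatten.
  by apply: eq_map => B; rewrite /= -map_comp /shifts add0r.
rewrite (map_comp (fun p : {set var m} * {set var m} =>
  deg (mono_set p.1) + deg_set p.2) val).
apply: perm_map; apply: uniq_perm.
- by rewrite map_inj_uniq ?enum_uniq //; exact: val_inj.
- apply: allpairs_uniq_dep; [exact: gen_seq_uniq | by move=> B _; exact: enum_uniq |].
  by move=> [B s] [B' s'] _ _ /= [-> ->].
move=> [B s]; apply/mapP/allpairsPdep => [[p _ pE]|[B' [s' [gB ss [-> ->]]]]].
  have := valP p; rewrite -pE => /and3P[gB sB ns]; exists B, s.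
  by rewrite mem_gen_seq mem_subsets inE gB sB.
have P : betti_pred I n.+1 (B', s').
  by move: gB ss; rewrite mem_gen_seq mem_subsets inE /betti_pred /= => -> /andP[-> ->].
by exists (Sub (B', s') P); rewrite ?mem_enum.
Qed.

Theorem corollary5p5 (K : fieldType) (d : nat) (m : 'I_d -> nat)
    (I : polyring K (var m) -> Prop) :
  (1 <= d)%N ->
  color_squarefree_ideal I ->
  stable_across_colors I ->
  ~ I 1 ->
  forall j : nat, (1 <= j)%N ->
  graded_iso (Tor j (gr_quot (M := gr_poly K (var m)) I)
                    (residue_field K (var m)))
             (betti_sum I j).
Proof.
move=> _ [monoI _] stI I1 [//|n] _.
have gM := gr_quot_monomial_graded monoI.
have IE : I = mideal (gen_by (gen_seq I)).
  by rewrite -(gen_by_gen_seq stI); exact: monomial_idealE.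
have nU1 : ~ gen_by (gen_seq I) mone.
  have /= <- := congr1 (fun U => U mone) (gen_by_gen_seq stI); exact: I1.
have := lin_quot_min_res K n.+1 0 (lin_quot_gen_seq stI).
rewrite {1}IE in gM.
move/(tor_monomial_quot (@gen_by_up _ _ _) nU1 gM) => [J [dg [LJ iso]]].
have [h [hb hE]] := perm_eq_bij (perm_trans (betti_index_degrees I n) LJ).
rewrite {1}IE; apply: graded_iso_trans iso _.
exact: sum_shift_reindex hb hE.
Qed.
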